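(* Let $\mathcal{Q}$ be a bipartite quiver represented by nontrivial finite-dimensional real Hilbert spaces $H_1,\dots,H_n$ (sources) and $H^1,\dots,H^m$ (targets) and surjective linear maps $B_a : H_i \to H^j$ for each arrow $a \in \mathcal{A}_{ij}$, where $\mathcal{A}_{ij}$ is the finite set of arrows from $H_i$ to $H^j$, and let $\mathbf{p} = (p_1,\dots,p_m)$ with $p_j \in [1,\infty]$ for each $1 \le j \le m$. Let $\mathrm{BL}(\mathcal{Q},\mathbf{p}) \in [0,\infty]$ denote the smallest constant $C$ for which the inequality $$\prod_{i=1}^n \int_{H_i} \prod_{j=1}^m \prod_{a \in \mathcal{A}_{ij}} f_a(B_a x)\, dx \;\le\; C \prod_{i=1}^n \prod_{j=1}^m \prod_{a \in \mathcal{A}_{ij}} \|f_a\|_{L^{p_j}(H^j)}$$ holds for all families of measurable functions $f_a : H^j \to [0,\infty]$ (one function for each arrow $a \in \mathcal{A}_{ij}$, for all $i,j$). Then $\mathrm{BL}(\mathcal{Q},\mathbf{p})$ is finite if and only if both of the following conditions hold: $$\sum_{i=1}^n \dim(H_i) = \sum_{i=1}^n \sum_{j=1}^m \sum_{a \in \mathcal{A}_{ij}} p_j^{-1} \dim(H^j)$$ and $$\sum_{i=1}^n \dim(V_i) \le \sum_{i=1}^n \sum_{j=1}^m \sum_{a \in \mathcal{A}_{ij}} p_j^{-1} \dim(B_a V_i) \quad \text{for all linear subspaces } V_1 \subseteq H_1, \dots, V_n \subseteq H_n.$$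
   Context: A quiver is a directed multigraph, here with finitely many vertices and arrows. It is bipartite if its vertex set is a disjoint union of two sets such that every arrow has its source in the first set and its target in the second. A representation assigns a vector space to each vertex and a linear map to each arrow (from the space at its source to the space at its target). Here the quiver is identified with a representation of it: the source vertices carry $H_1,\dots,H_n$, the target vertices carry $H^1,\dots,H^m$, and each arrow $a$ carries a surjective linear map $B_a$. Distinct vertices may carry equal spaces and distinct arrows may carry equal maps (multisets). ''Nontrivial'' means nonzero. Each Hilbert space carries the Lebesgue measure induced by its inner product. Conventions: $1/\infty = 0$ and $0\cdot\infty = 0$; empty products equal $1$. The constant $C$ is allowed to be infinite. *)

(* Defs.v *)
From HB Require Import structures.
From mathcomp Require Import all_boot all_order all_algebra.
From mathcomp Require Import all_classical all_reals all_analysis.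
From mathcomp Require Import measurable_realfun.
From mathcomp Require Import ring.

Set Implicit Arguments.
Unset Strict Implicit.
Unset Printing Implicit Defensive.
Import Order.TTheory GRing.Theory Num.Theory.
Import numFieldNormedType.Exports.

Local Open Scope classical_set_scope.
Local Open Scope ring_scope.

(* Finite-dimensional real Hilbert space: finite dimension makes completeness
   automatic. *)
Record hilbert (R : realType) := Hilbert {
  hvect :> vectType R ;
  inner : {dot hvect for idfun} }.
Arguments inner {R} h.

Definition hnorm (R : realType) (V : hilbert R) (x : V) : R :=
  Num.sqrt (inner V x x).

Definition hopen (R : realType) (V : hilbert R) : set (set V) :=
  [set A | forall x, A x ->
    exists2 e : R, 0 < e & forall y, hnorm (y - x) < e -> A y].

(* A vectType is not canonically a measurable space; [borel V] is the underlying
   set of [V] with the sigma-algebra generated by the norm-open sets. *)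
Definition carrier (R : realType) (V : hilbert R) : Type := V.
HB.instance Definition _ (R : realType) (V : hilbert R) :=
  Choice.on (carrier V).
HB.instance Definition _ (R : realType) (V : hilbert R) :=
  isPointed.Build (carrier V) (0 : V).

Definition borel (R : realType) (V : hilbert R) :=
  @g_sigma_algebraType (carrier V) (@hopen R V).

Section image_measure.
Context {d1 d2} {T1 : measurableType d1} {T2 : measurableType d2}.
Context {R : realType} (mu : {measure set T1 -> \bar R}) (f : T1 -> T2).
Hypothesis mf : measurable_fun setT f.

(* [pushforward mu f] bundled as a measure. *)
Definition image_measure : {measure set T2 -> \bar R} :=
  measure_function_pushforward__canonical__measure_function_Measure mu mf.
End image_measure.

Section tuple_lebesgue.
Variable R : realType.
Let T := measurableTypeR R.

Definition cons_pair d (p : d.-tuple T * T) : d.+1.-tuple T :=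
  [tuple of p.2 :: p.1].

Lemma measurable_cons_pair d : measurable_fun setT (@cons_pair d).
Proof. exact: measurable_cons. Qed.

(* d-fold product of the one-dimensional Lebesgue measure. *)
Fixpoint tuple_lebesgue d : {measure set (d.-tuple T) -> \bar R} :=
  if d is d'.+1 then
    image_measure (tuple_lebesgue d' \x @lebesgue_measure R)%E
      (@measurable_cons_pair d')
  else \d_[tuple].
End tuple_lebesgue.

Section orthonormal_basis.
Variables (R : realType) (V : hilbert R).
Local Notation "'[ u , v ]" := (inner V u v).

Lemma inner_sym u v : '[u, v] = '[v, u].
Proof. by rewrite hermC /= expr0 mul1r. Qed.

Lemma orthonormal_nth (s : seq V) i j : orthonormal (inner V) s ->
  (i < size s)%N -> (j < size s)%N -> '[s`_i, s`_j] = (i == j)%:R.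
Proof.
elim: s i j => // u s IH i j /andP[/=/andP[/eqP u1 s1] /andP[]].
rewrite /ortho_rec /= andbT => /allP/= us os.
case: i j => [|i] [|j]; rewrite ?ltnS /= ?eqSS => i_s j_s.
- by rewrite u1.
- exact/eqP/us/mem_nth.
- by rewrite inner_sym; apply/eqP/us/mem_nth.
- by apply: IH => //; rewrite /orthonormal s1.
Qed.

Lemma inner_suml (s : seq V) (c : 'I_(size s) -> R) (j : 'I_(size s)) :
  orthonormal (inner V) s -> '[\sum_i c i *: s`_i, s`_j] = c j.
Proof.
move=> os; rewrite linear_sumlz (bigD1 j) //= big1 => [|i ij].
  by rewrite linearZl_LR /= orthonormal_nth// eqxx mulr1 addr0.
by rewrite linearZl_LR /= orthonormal_nth// val_eqE (negPf ij) mulr0.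
Qed.

Lemma orthonormal_seq_exists k : (k <= \dim {:V})%N ->
  exists2 s : seq V, size s = k & orthonormal (inner V) s.
Proof.
elim: k => [_|k IH kV]; first by exists [::].
have [s sk os] := IH (ltnW kV).
have /subvPn[v _ vs] : ~~ ({:V} <= << s >>)%VS.
  apply/negP => /dimvS; rewrite leqNgt (leq_ltn_trans (dim_span s))//.
  by rewrite sk.
pose w := v - \sum_(i < size s) '[v, s`_i] *: s`_i.
have w0 : w != 0.
  apply: contra vs; rewrite subr_eq0 => /eqP ->.
  by apply: rpred_sum => i _; apply: rpredZ; rewrite memv_span// mem_nth.
have ws u : u \in s -> '[w, u] = 0.
  move=> /(nthP 0)[i i_s <-]; rewrite linearBl.
  apply/eqP; rewrite subr_eq0 eq_sym; apply/eqP.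
  exact: (inner_suml (fun i => '[v, s`_i]) (Ordinal i_s)) os.
exists ((hnorm w)^-1 *: w :: s); first by rewrite /= sk.
have ww : 0 < '[w, w] by exact: neq0_dnorm_gt0.
move: os => /andP[s1 s2]; rewrite /orthonormal /= s1 s2 !andbT.
apply/andP; split.
  rewrite linearZl_LR linearZr_LR /= mulrA -invfM -expr2 sqr_sqrtr ?ltW//.
  by rewrite mulVf// gt_eqF.
apply/allP => u us /=.
by rewrite linearZl_LR /= ws// mulr0.
Qed.

Lemma orthonormal_free (s : seq V) : orthonormal (inner V) s -> free s.
Proof.
move=> os; rewrite -[s]/(tval (in_tuple s)); apply/freeP => c cs i.
by rewrite -(@inner_suml s c i os) cs linear0l.
Qed.

Lemma orthonormal_basis_exists : exists e : (\dim {:V}).-tuple V,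
  orthonormal (inner V) e && basis_of {:V} e.
Proof.
have [s /eqP sV os] := orthonormal_seq_exists (leqnn _).
exists (Tuple sV); rewrite os /= basisEfree orthonormal_free// subvf /=.
by rewrite (eqP sV).
Qed.

Definition onb : (\dim {:V}).-tuple V := xchoose orthonormal_basis_exists.

Lemma onb_orthonormal : orthonormal (inner V) onb.
Proof. by case/andP: (xchooseP orthonormal_basis_exists). Qed.

Lemma onb_basis : basis_of {:V} onb.
Proof. by case/andP: (xchooseP orthonormal_basis_exists). Qed.

(* The isometry from R^d (as d-tuples) to V given by the orthonormal basis
   [onb]. *)
Definition onb_comb (t : (\dim {:V}).-tuple (measurableTypeR R)) : borel V :=
  \sum_(k < \dim {:V}) (tnth t k : R) *: tnth onb k.

Lemma inner_comb (c : 'I_(\dim {:V}) -> R) :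
  let x := \sum_k c k *: tnth onb k in '[x, x] = \sum_k c k ^+ 2.
Proof.
have onbE i j : '[tnth onb i, tnth onb j] = (i == j)%:R.
  by rewrite !(tnth_nth 0) orthonormal_nth ?size_tuple ?onb_orthonormal.
rewrite /= linear_sumlz; apply: eq_bigr => i _.
rewrite linear_sumr (bigD1 i)//= big1 => [|j ji].
  by rewrite linearZl_LR linearZr_LR/= onbE eqxx mulr1 addr0 expr2.
by rewrite linearZl_LR linearZr_LR/= onbE eq_sym (negPf ji) !mulr0.
Qed.

Lemma measurable_onb_comb : measurable_fun setT onb_comb.
Proof.
pose d := \dim {:V}.
have E : measurable = <<s @hopen R V >> :> set (set (borel V)) by [].
apply: (measurability _ E) => _ [A oA <-].
rewrite setTI.
pose box (q : {ffun 'I_d -> rat} * nat) : set (d.-tuple (measurableTypeR R)) :=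
  \bigcap_(k in [set: 'I_d]) (fun t => tnth t k) @^-1`
    `]ratr (q.1 k) - q.2.+1%:R^-1 : R, ratr (q.1 k) + q.2.+1%:R^-1[%classic.
have mbox q : measurable (box q).
  apply: fin_bigcap_measurable => // k _; rewrite -[X in measurable X]setTI.
  by apply: measurable_tnth => //; exact: measurable_itv.
have -> : onb_comb @^-1` A =
    \bigcup_(q in [set q | box q `<=` onb_comb @^-1` A]) box q.
  apply/seteqP; split=> [t At|t [q] /= ]; last by move=> /[apply].
  have [e e0 eA] := oA _ At.
  pose c : R := e / (2 * d.+1%:R).
  have c0 : 0 < c by rewrite divr_gt0// mulr_gt0.
  have [n _ /(_ n (leqnn n))/= nc] := near_infty_natSinv_lt (PosNum c0).
  have n0 : 0 < n.+1%:R^-1 :> R by rewrite invr_gt0.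
  have /fin_all_exists[q qP] (k : 'I_d) : exists r : rat,
      `|(tnth t k : R) - ratr r| < n.+1%:R^-1.
    have [|r] := @rat_in_itvoo R ((tnth t k : R) - n.+1%:R^-1)
                                 ((tnth t k : R) + n.+1%:R^-1).
      by rewrite ltrD2l (lt_trans _ n0)// oppr_lt0.
    by rewrite in_itv/= -ltr_distl distrC; exists r.
  exists ([ffun k => q k], n) => /=; last first.
    by move=> k _ /=; rewrite ffunE in_itv/= -ltr_distl.
  move=> s /= sP; apply: eA; rewrite /onb_comb -sumrB.
  under eq_bigr do rewrite -scalerBl.
  rewrite /hnorm inner_comb -(ger0_norm (ltW e0)) -sqrtr_sqr.
  have stc k : `|(tnth s k : R) - tnth t k| <= 2 * c.
    have := sP k I; rewrite /= ffunE in_itv/= -ltr_distl => sq.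
    rewrite (le_trans (ler_distD (ratr (q k)) _ _))// mulr2n mulrDl mul1r.
    rewrite lerD// ltW//; first exact: lt_trans sq nc.
    by rewrite distrC (lt_trans (qP k) nc).
  have c20 : 0 <= 2 * c by rewrite mulr_ge0// ltW.
  have e2 : e = (2 * c) * d.+1%:R by rewrite /c; field.
  rewrite ltr_sqrt ?exprn_gt0//.
  apply: (@le_lt_trans _ _ (\sum_(k < d) (2 * c) ^+ 2)).
    by apply: ler_sum => k _; rewrite -[leLHS]real_normK ?num_real// lerXn2r.
  rewrite sumr_const card_ord e2 -[ltLHS]mulr_natr [ltRHS]exprMn.
  rewrite ltr_pM2l; last by rewrite exprn_gt0// mulr_gt0.
  by rewrite -natrX ltr_nat (leq_trans (ltnSn d))// -mulnn leq_pmulr.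
rewrite bigcup_mkcond; apply: countable_bigcupT_measurable => // q.
by case: ifP.
Qed.

(* Image of the Lebesgue measure of R^d under a linear isometry R^d -> V; by
   orthogonal invariance, the choice of the orthonormal basis is immaterial. *)
Definition hilbert_lebesgue : {measure set (borel V) -> \bar R} :=
  image_measure (tuple_lebesgue R (\dim {:V})) measurable_onb_comb.

End orthonormal_basis.

Record bipartite_rep (R : realType) (n m : nat) := BipartiteRep {
  source : 'I_n -> hilbert R ;
  target : 'I_m -> hilbert R ;
  arrow : 'I_n -> 'I_m -> finType ;
  arrow_map : forall i j, arrow i j -> 'Hom(source i, target j) ;
  source_nontrivial : forall i, {: source i}%VS != 0%VS ;
  target_nontrivial : forall j, {: target j}%VS != 0%VS ;
  arrow_map_surj : forall i j (a : arrow i j),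
    forall y : target j, exists x : source i, arrow_map a x = y }.
Arguments arrow_map {R n m} _ {i j} a.

Section brascamp_lieb.
Context {R : realType} {n m : nat}.
Variables (Q : bipartite_rep R n m) (p : 'I_m -> \bar R).
Local Open Scope ereal_scope.

Definition BL_inequality (C : \bar R) : Prop :=
  forall f : (forall i j, arrow Q i j -> borel (target Q j) -> \bar R),
    (forall i j a, measurable_fun [set: borel (target Q j)] (f i j a)) ->
    (forall i j a y, 0 <= f i j a y) ->
    \prod_(i < n) \int[hilbert_lebesgue (source Q i)]_x
        \prod_(j < m) \prod_(a : arrow Q i j) f i j a (arrow_map Q a x)
    <= C * \prod_(i < n) \prod_(j < m) \prod_(a : arrow Q i j)
             'N[hilbert_lebesgue (target Q j)]_(p j)[f i j a].

Definition BL_constant : \bar R :=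
  ereal_inf [set C | 0 <= C /\ BL_inequality C].

End brascamp_lieb.

(* Main.v *)
From HB Require Import structures.
From mathcomp Require Import all_boot all_order all_algebra.
From mathcomp Require Import all_classical all_reals all_analysis.
From mathcomp Require Import measurable_realfun ess_sup_inf.
From mathcomp Require Import ring lra.
Require Import Defs.

(* The left-hand side factors over the sources, and so do the two conditions
   (fill all other sources with the zero subspace), so everything reduces to one
   source, that is, to the Brascamp-Lieb inequality
     int_U prod_j f_j(l_j x)^(th_j) dx <= C prod_j (int f_j)^(th_j),  th_j = 1/p_j,
   whose finiteness is proved by induction on dim U, following Bennett, Carbery,
   Christ and Tao.  If some proper nonzero V is critical (equality in the
   dimension condition), integrate first over V and then over a complement.
   If th_j = 1 for a factor with l_j U <> 0, then U cap ker l_j is critical, hence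
   zero, and the inequality is a linear change of variables.  Otherwise two
   exponents lie strictly between 0 and 1; moving weight from one to the other, in
   either direction, until a constraint becomes tight writes th as a convex
   combination of exponents that are already settled, and Hoelder's inequality
   interpolates.

   Conversely, test functions adapted to the dilations by e^x along V and e^y along
   a complement, with y <= x, give
     x A1 + y A2 <= const + x B1 + y B2
   where A1, A2 are the total dimensions of the V_i and of their complements, and
   B1, B2 those of the images, weighted by 1/p_j.  Letting x = y -> +-oo gives the
   scaling identity, and x = 0, y -> -oo the dimension condition.

   All integrals are handled as iterated one-dimensional integrals along lists of
   vectors, so that a change of variables is a change of basis. *)

Set Implicit Arguments.
Unset Strict Implicit.
Unset Printing Implicit Defensive.
Import Order.TTheory GRing.Theory Num.Theory.
Import numFieldNormedType.Exports.

Local Open Scope classical_set_scope.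
Local Open Scope ring_scope.

(** * Lebesgue integrals on the line *)

Section line_integrals.
Variable R : realType.
Local Open Scope ereal_scope.
Local Notation leb := (@lebesgue_measure R).

(** The pushforward of Lebesgue measure under a translation agrees with it on half-open intervals,
    hence everywhere by uniqueness. *)
Lemma lebesgue_integral_shift (f : R -> \bar R) (a : R) :
  measurable_fun setT f -> (forall x, 0 <= f x) ->
  \int[leb]_x f (x + a)%R = \int[leb]_x f x.
Proof.
move=> mf f0.
have mphi : measurable_fun setT (fun x : measurableTypeR R => (x + a)%R : measurableTypeR R).
  by apply: measurable_funD.
transitivity (\int[pushforward leb (fun x : measurableTypeR R => (x + a)%R : measurableTypeR R)]_x f x).
  by rewrite ge0_integral_pushforward.
apply: eq_measure_integral => A mA _; apply/esym.
apply: (@lebesgue_measure_unique R (image_measure leb mphi)) => // _ [[b c]] _ <-.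
rewrite /= /pushforward.
have -> : (fun x => x + a)%R @^-1` `](b, c).1, (b, c).2]%classic = `](b - a)%R, (c - a)%R]%classic.
  by apply/seteqP; split => x /=; rewrite !in_itv/= ltrBlDr lerBrDr.
by rewrite !lebesgue_measure_itv /= !lte_fin ltrD2r -!EFinB; case: ifP => // _; congr (_%:E); ring.
Qed.

Lemma lebesgue_integral_scale (f : R -> \bar R) (a : R) : a != 0%R ->
  measurable_fun setT f -> (forall x, 0 <= f x) ->
  \int[leb]_x f (x * a)%R = (`|a|^-1)%:E * \int[leb]_x f x.
Proof.
move=> a0 mf f0.
have mphi : measurable_fun setT (fun x : measurableTypeR R => (x * a)%R : measurableTypeR R).
  by apply: measurable_funM.
have na0 : (0 < `|a|)%R by rewrite normr_gt0.
pose k := NngNum (normr_ge0 a).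
suff H : \int[leb]_x f x = `|a|%:E * \int[leb]_x f (x * a)%R.
  by rewrite H muleA -EFinM mulVf ?mul1e ?gt_eqF.
transitivity (`|a|%:E * \int[image_measure leb mphi]_x f x); last first.
  by rewrite ge0_integral_pushforward.
rewrite -(@ge0_integral_mscale _ _ _ _ _ measurableT k)//.
apply: eq_measure_integral => A mA _.
apply: lebesgue_measure_unique => // _ [[b c]] _ <-.
rewrite /= /mscale /= /pushforward.
have [a1|a1|a1] := ltgtP a 0%R; last by rewrite a1 eqxx in a0.
(* For negative [a] the endpoints trade places, so the preimage is closed on the left and open on
   the right; its measure is still its length. *)
- have -> : (fun x => x * a)%R @^-1` `](b, c).1, (b, c).2]%classic = `[(c / a)%R, (b / a)%R[%classic.
    apply/seteqP; split => x /=; rewrite !in_itv/=.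
      by move=> /andP[h1 h2]; rewrite ler_ndivrMr// ltr_ndivlMr// h2 h1.
    by move=> /andP[]; rewrite ler_ndivrMr// ltr_ndivlMr// => -> ->.
  rewrite !lebesgue_measure_itv /= !lte_fin ltr_nM2r ?invr_lt0// -!EFinB.
  case: ifP; rewrite ?mule0// => _; rewrite -EFinM ltr0_norm//; congr (_%:E).
  by field.
- have -> : (fun x => x * a)%R @^-1` `](b, c).1, (b, c).2]%classic = `](b / a)%R, (c / a)%R]%classic.
    by apply/seteqP; split => x /=; rewrite !in_itv/= ltr_pdivrMr// ler_pdivlMr.
  rewrite !lebesgue_measure_itv /= !lte_fin ltr_pM2r ?invr_gt0// -!EFinB.
  case: ifP; rewrite ?mule0// => _; rewrite -EFinM gtr0_norm//; congr (_%:E).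
  by field.
Qed.

Lemma young_poweR (x y : \bar R) (t : R) : (0 < t < 1)%R -> 0 <= x -> 0 <= y ->
  x `^ t * y `^ (1 - t) <= t%:E * x + (1 - t)%:E * y.
Proof.
move=> /andP[t0 t1]; have t1' : (0 < 1 - t)%R by rewrite subr_gt0.
case: x => [x| |]//; case: y => [y| |]//.
- rewrite !lee_fin => x0 y0.
  have := @conjugate_powR R (x `^ t)%R (y `^ (1 - t))%R t^-1%R (1 - t)^-1%R
    (powR_ge0 _ _) (powR_ge0 _ _).
  rewrite !invr_gt0 t0 t1' => /(_ isT isT).
  rewrite !invrK -!powRrM !mulfV ?gt_eqF// !powRr1//.
  rewrite [(t * x)%R]mulrC [((1 - t) * y)%R]mulrC => -> //.
  by rewrite addrCA subrr addr0.
- move=> x0 _; rewrite [(1 - t)%:E * +oo]mulry gtr0_sg// mul1e.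
  by rewrite addey ?leey.
- move=> _ y0; rewrite [t%:E * +oo]mulry gtr0_sg// mul1e.
  by rewrite addye ?leey.
- by rewrite [(1 - t)%:E * +oo]mulry gtr0_sg// mul1e addey ?leey// mulry gtr0_sg// mul1e.
Qed.

(** Once both integrals are normalized to 1, Young's inequality holds pointwise and integrates to
    the bound. Zero or infinite integrals are treated apart, since values in [0, oo] are allowed. *)
Lemma hoelder_poweR d (T : measurableType d) (mu : {measure set T -> \bar R})
    (f g : T -> \bar R) (t : R) : (0 < t < 1)%R ->
  measurable_fun setT f -> measurable_fun setT g ->
  (forall x, 0 <= f x) -> (forall x, 0 <= g x) ->
  \int[mu]_x (f x `^ t * g x `^ (1 - t)) <=
  (\int[mu]_x f x) `^ t * (\int[mu]_x g x) `^ (1 - t).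
Proof.
move=> t01 mf mg f0 g0; have /andP[t0 t1] := t01.
have t1' : (0 < 1 - t)%R by rewrite subr_gt0.
have mft : measurable_fun setT (fun x => f x `^ t).
  exact: (measurableT_comp (measurable_poweR _)).
have mgt : measurable_fun setT (fun x => g x `^ (1 - t)).
  exact: (measurableT_comp (measurable_poweR _)).
have mfg : measurable_fun setT (fun x => f x `^ t * g x `^ (1 - t)).
  exact: emeasurable_funM.
have fg0 x : 0 <= f x `^ t * g x `^ (1 - t) by rewrite mule_ge0 ?poweR_ge0.
set A := \int[mu]_x f x; set B := \int[mu]_x g x.
have A0 : 0 <= A by exact: integral_ge0.
have B0 : 0 <= B by exact: integral_ge0.
(* A vanishing integral makes its function zero almost everywhere, hence the product too, even where
   the other factor is infinite. *)
have zero : (A = 0 \/ B = 0) -> \int[mu]_x (f x `^ t * g x `^ (1 - t)) = 0.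
  move=> AB; apply/eqP; rewrite -(ae_eq_integral_abs mu measurableT mfg).2 //.
    by apply/eqP/eq_integral => x _; rewrite gee0_abs.
  case: AB => h.
    have : \int[mu]_x `|f x| = 0 by rewrite -[RHS]h; apply: eq_integral => x _; rewrite gee0_abs.
    move/(ae_eq_integral_abs mu measurableT mf) => h'.
    by apply: filterS h' => x /(_ I) fx _; rewrite fx poweR0r ?gt_eqF// mul0e.
  have : \int[mu]_x `|g x| = 0 by rewrite -[RHS]h; apply: eq_integral => x _; rewrite gee0_abs.
  move/(ae_eq_integral_abs mu measurableT mg) => h'.
  by apply: filterS h' => x /(_ I) gx _; rewrite gx poweR0r ?gt_eqF// mule0.
have [A00|A00] := eqVneq A 0; first by rewrite zero ?mule_ge0 ?poweR_ge0//; left.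
have [B00|B00] := eqVneq B 0; first by rewrite zero ?mule_ge0 ?poweR_ge0//; right.
have Ap : 0 < A `^ t by rewrite poweR_gt0// lt0e A00.
have Bp : 0 < B `^ (1 - t) by rewrite poweR_gt0// lt0e B00.
have [Ay|Ay] := eqVneq A +oo.
  by rewrite [X in X `^ t]Ay poweRyr ?gt_eqF// gt0_mulye// leey.
have [By|By] := eqVneq B +oo.
  by rewrite [X in _ * X `^ _]By poweRyr ?gt_eqF// gt0_muley// leey.
have [a Aa] : exists a, A = a%:E by exists (fine A); rewrite fineK// ge0_fin_numE// ltey.
have [b Bb] : exists b, B = b%:E by exists (fine B); rewrite fineK// ge0_fin_numE// ltey.
have a0 : (0 < a)%R by rewrite -lte_fin -Aa lt0e A00.
have b0 : (0 < b)%R by rewrite -lte_fin -Bb lt0e B00.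
(* [K] undoes the normalization of [f] by [a] and of [g] by [b]. *)
pose K := (a `^ t * b `^ (1 - t))%R.
have K0 : (0 <= K)%R by rewrite mulr_ge0 ?powR_ge0.
have fa0 x : 0 <= a^-1%:E * f x by rewrite mule_ge0// lee_fin invr_ge0 ltW.
have gb0 x : 0 <= b^-1%:E * g x by rewrite mule_ge0// lee_fin invr_ge0 ltW.
have mfa : measurable_fun setT (fun x => a^-1%:E * f x) by exact: measurable_funeM.
have mgb : measurable_fun setT (fun x => b^-1%:E * g x) by exact: measurable_funeM.
have bound x : f x `^ t * g x `^ (1 - t) <=
    K%:E * (t%:E * (a^-1%:E * f x) + (1 - t)%:E * (b^-1%:E * g x)).
  have -> : f x `^ t * g x `^ (1 - t) =
      K%:E * ((a^-1%:E * f x) `^ t * (b^-1%:E * g x) `^ (1 - t)).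
    rewrite !poweRM ?lee_fin ?invr_ge0 ?(ltW a0) ?(ltW b0)// !poweR_EFin.
    rewrite (muleACA _ (f x `^ t)) -EFinM [RHS]muleA -EFinM.
    rewrite /K mulrACA -!powRM ?invr_ge0 ?(ltW a0) ?(ltW b0)// !mulfV ?gt_eqF//.
    by rewrite !powR1 mulr1 mul1e.
  by rewrite lee_pmul2l ?lte_fin ?mulr_gt0 ?powR_gt0// young_poweR.
apply: le_trans.
  apply: ge0_le_integral => //; last by move=> x _; exact: bound.
  apply: measurable_funeM; apply: emeasurable_funD; exact: measurable_funeM.
have tf0 x : 0 <= t%:E * (a^-1%:E * f x) by rewrite mule_ge0// lee_fin ltW.
have tg0 x : 0 <= (1 - t)%:E * (b^-1%:E * g x) by rewrite mule_ge0// lee_fin ltW.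
rewrite ge0_integralZl//; first last.
- by move=> x _; rewrite adde_ge0.
- by apply: emeasurable_funD; exact: measurable_funeM.
rewrite ge0_integralD//; [|exact: measurable_funeM|exact: measurable_funeM].
rewrite !ge0_integralZl ?lee_fin ?invr_ge0 ?(ltW a0) ?(ltW b0) ?(ltW t0) ?(ltW t1')//.
rewrite -/A -/B Aa Bb.
suff : (K * (t * (a^-1 * a) + (1 - t) * (b^-1 * b)) <= a `^ t * b `^ (1 - t))%R.
  by rewrite -lee_fin.
by rewrite !mulVf ?gt_eqF// !mulr1 addrCA subrr addr0 mulr1.
Qed.
End line_integrals.

(** * Iterated integrals along a list of vectors *)

Section weak_measurability.
Variables (R : realType) (E : vectType R).

(* [E] carries no sigma-algebra here: maps into [E] are tested against linear
   forms, and functions on [E] against the maps so obtained. *)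
Definition wmeas d (T : measurableType d) (g : T -> E) :=
  forall phi : 'Hom(E, R^o), measurable_fun setT (fun t => phi (g t) : measurableTypeR R).

Definition vmeas (F : E -> \bar R) :=
  forall d (T : measurableType d) (g : T -> E), wmeas g -> measurable_fun setT (F \o g).

Lemma wmeas_cst d (T : measurableType d) x : wmeas (fun _ : T => x).
Proof. by move=> phi; exact: measurable_cst. Qed.

Lemma wmeasD d (T : measurableType d) (g h : T -> E) :
  wmeas g -> wmeas h -> wmeas (fun t => g t + h t).
Proof.
move=> mg mh phi; under eq_fun do rewrite linearD.
exact: (measurable_funD (mg phi) (mh phi)).
Qed.

Lemma wmeasZ d (T : measurableType d) (s : T -> measurableTypeR R) (v : E) :
  measurable_fun setT s -> wmeas (fun t => (s t : R) *: v).
Proof.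
move=> ms phi; under eq_fun do rewrite linearZ.
exact: measurable_funM.
Qed.

Lemma wmeas_comp d d' (T : measurableType d) (T' : measurableType d')
    (h : T' -> T) (g : T -> E) :
  measurable_fun setT h -> wmeas g -> wmeas (g \o h).
Proof. by move=> mh mg phi; apply: (measurableT_comp (mg phi)). Qed.

Lemma vmeas_cst k : vmeas (fun=> k).
Proof. by move=> d T g mg; exact: measurable_cst. Qed.

Lemma vmeas_shift F x : vmeas F -> vmeas (fun y => F (x + y)).
Proof.
by move=> mF d T g mg; apply: mF; apply: wmeasD => //; exact: wmeas_cst.
Qed.

Lemma vmeas_poweR F (t : R) : vmeas F -> vmeas (fun y => F y `^ t)%E.
Proof. by move=> mF d T g /mF ?; exact: (measurableT_comp (measurable_poweR _)). Qed.

Lemma vmeasM F G : vmeas F -> vmeas G -> vmeas (fun y => F y * G y)%E.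
Proof. by move=> mF mG d T g mg; apply: emeasurable_funM; [exact: mF|exact: mG]. Qed.

Lemma vmeas_prod (I : Type) (r : seq I) (F : I -> E -> \bar R) :
  (forall i, vmeas (F i)) -> vmeas (fun y => \prod_(i <- r) F i y)%E.
Proof.
move=> mF; elim: r => [|i r IH].
  by under eq_fun do rewrite big_nil; exact: vmeas_cst.
by under eq_fun do rewrite big_cons; exact: vmeasM.
Qed.

Lemma vmeas_line F x v : vmeas F ->
  measurable_fun setT (fun s : measurableTypeR R => F (x + (s : R) *: v)).
Proof.
move=> mF; apply: (mF _ _ (fun s : measurableTypeR R => x + (s : R) *: v)).
by apply: wmeasD; [exact: wmeas_cst|apply: wmeasZ].
Qed.

End weak_measurability.

Lemma wmeas_hom (R : realType) (E E' : vectType R) (l : 'Hom(E, E')) d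
  (T : measurableType d) (g : T -> E) : wmeas g -> wmeas (l \o g).
Proof.
move=> mg phi; have := mg (phi \o l)%VF.
by under eq_fun do rewrite comp_lfunE.
Qed.

Lemma vmeas_hom (R : realType) (E E' : vectType R) (l : 'Hom(E, E')) F :
  vmeas F -> vmeas (fun x => F (l x)).
Proof. by move=> mF d T g mg; apply: mF; exact: wmeas_hom. Qed.

Lemma vmeas_prod_poweR (R : realType) (E : vectType R) (J : finType)
    (H : J -> vectType R) (l : forall j, 'Hom(E, H j)) (f : forall j, H j -> \bar R)
    (th : J -> R) : (forall j, vmeas (f j)) ->
  vmeas (fun x => \prod_j f j (l j x) `^ th j)%E.
Proof.
move=> mf; apply: vmeas_prod => j.
by apply: (@vmeas_hom _ _ _ (l j) (fun y => f j y `^ th j)%E); exact: vmeas_poweR.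
Qed.

(* The integral of [F] over the affine subspace [x + <<b>>], with respect to the
   coordinates given by the vectors in [b]. *)
Fixpoint iint (R : realType) (E : vectType R) (b : seq E) (F : E -> \bar R) (x : E) : \bar R :=
  if b is v :: b' then (\int[@lebesgue_measure R]_s iint b' F (x + (s : R) *: v))%E
  else F x.

Section iterated_integral.
Variables (R : realType) (E : vectType R).
Local Open Scope ereal_scope.
Implicit Types (b : seq E) (F G : E -> \bar R) (x y u v : E).

Lemma iint_ge0 b F x : (forall y, 0 <= F y) -> 0 <= iint b F x.
Proof.
by move=> F0; elim: b x => //= v b IH x; apply: integral_ge0.
Qed.

Lemma vmeas_iint b F : vmeas F -> (forall y, 0 <= F y) -> vmeas (iint b F).
Proof.
move=> mF F0; elim: b => //= v b IH d T g mg.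
pose f (p : T * measurableTypeR R) := iint b F (g p.1 + (p.2 : R) *: v)%R.
apply: (@measurable_fun_fubini_tonelli_F _ _ _ _ _ (@lebesgue_measure R) f).
- apply: (IH _ _ (fun p : T * measurableTypeR R => g p.1 + (p.2 : R) *: v)%R).
  apply: wmeasD; first by apply: (wmeas_comp _ mg); exact: measurable_fst.
  by apply: wmeasZ; exact: measurable_snd.
- by move=> p; exact: iint_ge0.
Qed.

Lemma measurable_iint_line b F x v : vmeas F -> (forall y, 0 <= F y) ->
  measurable_fun setT (fun s : measurableTypeR R => iint b F (x + (s : R) *: v)%R).
Proof. by move=> mF F0; apply: vmeas_line; exact: vmeas_iint. Qed.

Lemma eq_iint b F G x : F =1 G -> iint b F x = iint b G x.
Proof.
by move=> FG; elim: b x => //= v b IH x; apply: eq_integral => s _; exact: IH.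
Qed.

Lemma iint_le b F G x : vmeas F -> vmeas G -> (forall y, 0 <= F y) ->
  (forall y, F y <= G y) -> iint b F x <= iint b G x.
Proof.
move=> mF mG F0 FG; have G0 y : 0 <= G y by exact: le_trans (FG y).
elim: b x => //= v b IH x; apply: ge0_le_integral => //.
- by move=> s _; exact: iint_ge0.
- exact: measurable_iint_line.
- exact: measurable_iint_line.
Qed.

Lemma iintZ b F x k : vmeas F -> (forall y, 0 <= F y) -> 0 <= k ->
  iint b (fun y => k * F y) x = k * iint b F x.
Proof.
move=> mF F0 k0; elim: b x => //= v b IH x.
under eq_integral do rewrite IH.
rewrite ge0_integralZl//; first exact: measurable_iint_line.
by move=> s _; exact: iint_ge0.
Qed.

Lemma iint_cat b b' F x : iint (b ++ b') F x = iint b (iint b' F) x.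
Proof.
by elim: b x => //= v b IH x; apply: eq_integral => s _; exact: IH.
Qed.

(** Tonelli carries the integration along [u] inward, past one vector of [b] at a time. *)
Lemma iint_swap b u F x : vmeas F -> (forall y, 0 <= F y) ->
  iint (u :: b) F x = iint b (iint [:: u] F) x.
Proof.
move=> mF F0; elim: b x => // v b IH x.
have -> : iint (v :: b) (iint [:: u] F) x = iint (v :: u :: b) F x.
  by apply: eq_integral => s _; exact/esym/IH.
rewrite /=.
pose f (p : measurableTypeR R * measurableTypeR R) :=
  iint b F (x + (p.1 : R) *: u + (p.2 : R) *: v)%R.
have mf : measurable_fun setT f.
  apply: (vmeas_iint b mF F0
    (g := fun p : measurableTypeR R * measurableTypeR R =>
      x + (p.1 : R) *: u + (p.2 : R) *: v)%R).
  apply: wmeasD; last by apply: wmeasZ; exact: measurable_snd.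
  apply: wmeasD; first exact: wmeas_cst.
  by apply: wmeasZ; exact: measurable_fst.
have f0 p : 0 <= f p by exact: iint_ge0.
have := @fubini_tonelli _ _ _ _ R (@lebesgue_measure R) (@lebesgue_measure R) f mf f0.
rewrite /f /= => ->.
by apply: eq_integral => t _; apply: eq_integral => s _; rewrite addrAC.
Qed.

Lemma iint_comm b b' F x : vmeas F -> (forall y, 0 <= F y) ->
  iint b (iint b' F) x = iint b' (iint b F) x.
Proof.
move=> mF F0; elim: b' x => // v b' IH x.
have e y : iint (v :: b') F y = iint [:: v] (iint b' F) y by [].
rewrite (eq_iint _ _ e) -iint_swap//.
- by apply: eq_integral => s _; exact: IH.
- exact: vmeas_iint.
- by move=> y; exact: iint_ge0.
Qed.

(** Exchanges of adjacent blocks generate all permutations, so [iint_comm] suffices. *)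
Lemma perm_iint b b' F x : vmeas F -> (forall y, 0 <= F y) ->
  perm_eq b b' -> iint b F x = iint b' F x.
Proof.
move=> mF F0 bb'; apply/esym.
pattern b'; apply: (catCA_perm_ind _ bb') => // s1 s2 s3 <-.
rewrite !iint_cat; under eq_iint do rewrite iint_cat.
under [RHS]eq_iint do rewrite iint_cat.
rewrite -iint_comm//; first exact: vmeas_iint.
by move=> y; exact: iint_ge0.
Qed.

Lemma iint_shift b F x y :
  iint b F (x + y)%R = iint b (fun z => F (x + z)%R) y.
Proof.
elim: b y => //= v b IH y; apply: eq_integral => s _.
by rewrite -addrA IH.
Qed.

(** The component of [y] along the head of [b] is absorbed by a shift in the outermost line
    integral, the rest by induction. *)
Lemma iint_invariant b F x y : vmeas F -> (forall z, 0 <= F z) ->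
  (y \in <<b>>)%VS -> iint b F (x + y)%R = iint b F x.
Proof.
move=> mF F0; elim: b x y => [|v b IH] x y.
  by rewrite span_nil memv0 => /eqP ->; rewrite addr0.
rewrite span_cons => /memv_addP[_ /vlineP[c ->]] [z zb ->] /=.
rewrite -[RHS](lebesgue_integral_shift c); last 2 first.
- exact: measurable_iint_line.
- by move=> s; exact: iint_ge0.
apply: eq_integral => s _; rewrite -[RHS](IH _ z)//; congr iint.
by rewrite scalerDl !addrA [LHS]addrAC; congr (_ + _)%R; rewrite addrAC.
Qed.

(** Induction handles the inner integrals; one more Hoelder inequality on the line handles the
    outermost variable. *)
Lemma hoelder_iint b F G x (t : R) : (0 < t < 1)%R ->
  vmeas F -> vmeas G -> (forall z, 0 <= F z) -> (forall z, 0 <= G z) ->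
  iint b (fun z => F z `^ t * G z `^ (1 - t)) x <=
  iint b F x `^ t * iint b G x `^ (1 - t).
Proof.
move=> t01 mF mG F0 G0; elim: b x => //= v b IH x.
have mH : vmeas (fun z => F z `^ t * G z `^ (1 - t)).
  by apply: vmeasM; exact: vmeas_poweR.
have H0 z : 0 <= F z `^ t * G z `^ (1 - t) by rewrite mule_ge0 ?poweR_ge0.
apply: le_trans; last first.
  apply: hoelder_poweR => //.
  - exact: measurable_iint_line.
  - exact: measurable_iint_line.
  - by move=> s; exact: iint_ge0.
  - by move=> s; exact: iint_ge0.
apply: ge0_le_integral => //.
- by move=> s _; exact: iint_ge0.
- exact: measurable_iint_line.
- apply: emeasurable_funM;
  by apply: (measurableT_comp (measurable_poweR _)); exact: measurable_iint_line.
Qed.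

End iterated_integral.

Lemma iint_hom (R : realType) (E E' : vectType R) (l : 'Hom(E, E')) b F x :
  iint b (fun y => F (l y)) x = iint (map l b) F (l x).
Proof.
elim: b x => //= v b IH x; apply: eq_integral => s _.
by rewrite IH linearD linearZ.
Qed.

(** * Change of basis *)

Section basis_change.
Variables (R : realType) (E : vectType R).
Local Open Scope ereal_scope.
Implicit Types (b : seq E) (F G : E -> \bar R) (x y u v : E).

(** Steinitz exchange: since [c] is nonzero, [v] can take the place of [w], leaving [r]
    unchanged. *)
Lemma mem_span_exchange b v : (v \in <<b>>)%VS -> v != 0%R ->
  exists w r (c : R) y, [/\ perm_eq b (w :: r), (v = c *: w + y)%R,
    (y \in << r >>)%VS & c != 0%R].
Proof.
elim: b v => [|u b IH] v.
  by rewrite span_nil memv0 => ->.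
rewrite span_cons => /memv_addP[_ /vlineP[c ->]] [z zb ->] v0.
have [c0|c0] := eqVneq c 0%R; last by exists u, b, c, z; split.
move: v0; rewrite c0 scale0r add0r => /(IH z zb)[w [r [c' [y [bwr -> yr c'0]]]]].
exists w, (u :: r), c', y; split => //; last first.
  by rewrite span_cons; apply: subvP yr; exact: addvSr.
rewrite -(perm_cons u) in bwr; apply: (perm_trans bwr).
exact: (permEl (perm_catCA [:: u] [:: w] r)).
Qed.

(** The head [v] of [b] is exchanged for a vector [w] of [b']. The integral along [v] does not see
    components along [v], so the tail of [b] may be projected along [v] into the span of the
    remaining vectors [r], where induction applies. The inequality suffices, as it can be used with
    the bases in either order. *)
Lemma iint_rebase b b' : size b = size b' -> free b' -> (<<b'>> <= <<b>>)%VS ->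
  exists C : R, (0 < C)%R /\ forall F x, vmeas F -> (forall y, 0 <= F y) ->
    iint b F x <= C%:E * iint b' F x.
Proof.
have [k sk] := ubnP (size b); elim: k b b' sk => // k IHk [|v b] b' sk sb fb' b'b.
  by case: b' sb {fb' b'b} => // _; exists 1%R; split => // F x _ F0 /=; rewrite mul1e.
have spE : (<<b'>> = <<v :: b>>)%VS.
  apply/eqP; rewrite eqEdim b'b /= (eqP (fb' : \dim <<b'>> == size b'))%N.
  by rewrite -sb dim_span.
have fvb : free (v :: b) by rewrite /free -spE sb.
have v0 : v != 0%R by apply: contraTneq fvb => ->; rewrite free_cons mem0v.
have vb' : (v \in <<b'>>)%VS by rewrite spE memv_span// mem_head.
have [w [r [c [y [b'wr vE yr c0]]]]] := mem_span_exchange vb' v0.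
have fwr : free (w :: r) by rewrite -(perm_free b'wr).
have vr : v \notin << r >>%VS.
  move: (fwr); rewrite free_cons => /andP[wr _]; apply: contra wr => vr.
  have -> : w = c^-1 *: (v - y) by rewrite vE addrK scalerA mulVf// scale1r.
  by rewrite memvZ// memvB.
have fr : free r by move: fwr; rewrite free_cons => /andP[].
have dis : (<[v]> :&: << r >> = 0)%VS.
  apply/eqP; rewrite -subv0; apply/subvP => z; rewrite memv_cap memv0.
  move=> /andP[/vlineP[a ->] kr]; rewrite scaler_eq0; apply/orP; left.
  by apply: contraNT vr => a0; rewrite -(scale1r v) -(mulVf a0) -scalerA memvZ.
(* [phi] moves points only along [v], kills [v] and fixes the span of [r]. *)
pose phi : 'End(E) := (\1%VF - daddv_pi <[v]> << r >>)%R.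
have phiE z : (z - phi z)%R \in <[v]>%VS.
  rewrite /phi add_lfunE opp_lfunE id_lfunE subKr; exact: memv_pi.
have phiv : phi v = 0%R.
  by rewrite /phi add_lfunE opp_lfunE id_lfunE daddv_pi_id ?memv_line// subrr.
have phir z : (z \in << r >>)%VS -> phi z = z.
  move=> zr; have disC : (<< r >> :&: <[v]> = 0)%VS by rewrite capvC.
  have := @daddv_pi_add _ _ _ _ z dis.
  rewrite (subvP (addvSr _ _) _ zr) => /(_ isT).
  rewrite (daddv_pi_id disC zr) /phi add_lfunE opp_lfunE id_lfunE => {1}<-.
  by rewrite addrC addKr.
have sr : size (map phi b) = size r.
  by move: sb; rewrite size_map (perm_size b'wr) /= => -[].
have skb : (size (map phi b) < k)%N by rewrite size_map.
have rb : (<< r >> <= <<map phi b>>)%VS.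
  apply/subvP => z zr; rewrite -limg_span -(phir z zr).
  have : (z \in <<v :: b>>)%VS.
    rewrite -spE (eq_span (perm_mem b'wr)) span_cons; exact: subvP (addvSr _ _) _ zr.
  rewrite span_cons => /memv_addP[_ /vlineP[a ->]] [u ub ->].
  by rewrite linearD linearZ /= phiv scaler0 add0r memv_img.
have [C [C0 HC]] := IHk (map phi b) r skb sr fr rb.
exists (C * `|c|^-1)%R; split; first by rewrite mulr_gt0// invr_gt0 normr_gt0.
move=> F x mF F0.
pose G := iint [:: v] F.
have mG : vmeas G by exact: vmeas_iint.
have G0 z : 0 <= G z by exact: iint_ge0.
have Gphi z : G (phi z) = G z.
  have e : z = (phi z + (z - phi z))%R by rewrite addrC subrK.
  by rewrite [in RHS]e /G iint_invariant// span_seq1.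
have -> : iint (v :: b) F x = iint (v :: map phi b) F x.
  rewrite !iint_swap// -(eq_iint b x Gphi) iint_hom.
  have e z : iint (map phi b) G z = iint (v :: map phi b) F z by rewrite iint_swap.
  have ex : x = (phi x + (x - phi x))%R by rewrite addrC subrK.
  rewrite -/G !e [in RHS]ex iint_invariant// span_cons.
  exact: subvP (addvSl _ _) _ (phiE x).
rewrite (perm_iint x mF F0 b'wr) EFinM -muleA.
(* Substituting [v = c *: w + y], the factor [c] rescales the line integral and [y] is absorbed by
   translation along [r]. *)
have -> : `|c|^-1%:E * iint (w :: r) F x = iint (v :: r) F x.
  rewrite /= -lebesgue_integral_scale//; last 2 first.
  - exact: measurable_iint_line.
  - by move=> s; exact: iint_ge0.
  apply: eq_integral => s _; rewrite vE scalerDr addrA scalerA.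
  by rewrite [RHS]iint_invariant// memvZ.
rewrite /= -ge0_integralZl//; last 3 first.
- exact: measurable_iint_line.
- by move=> s _; exact: iint_ge0.
- by rewrite lee_fin ltW.
apply: ge0_le_integral => //.
- by move=> s _; exact: iint_ge0.
- exact: measurable_iint_line.
- by apply: measurable_funeM; exact: measurable_iint_line.
- by move=> s _; exact: HC.
Qed.

Lemma iint_basis b b' (U : {vspace E}) : basis_of U b -> basis_of U b' ->
  exists C : R, (0 < C)%R /\ forall F x, vmeas F -> (forall y, 0 <= F y) ->
    iint b F x <= C%:E * iint b' F x.
Proof.
move=> /andP[/eqP bU fb] /andP[/eqP b'U fb']; apply: iint_rebase => //.
  by rewrite -(eqP (fb : \dim <<b>> == size b))%N -(eqP (fb' : \dim <<b'>> == size b'))%N bU b'U.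
by rewrite bU b'U.
Qed.

End basis_change.

(** * Brascamp-Lieb data and the factorization through a critical subspace *)

Section ereal_power.
Variable R : realType.
Local Open Scope ereal_scope.

Lemma poweRD_ge0 (x : \bar R) (a b : R) : 0 <= x -> (0 <= a)%R -> (0 <= b)%R ->
  x `^ (a + b) = x `^ a * x `^ b.
Proof.
move=> x0 a0 b0; have [->|xn0] := eqVneq x 0; last first.
  by apply: poweRD; exact: nneg_neq0_poweRD_def.
have [ab|ab] := eqVneq (a + b)%R 0%R; last first.
  by apply: poweRD; exact: add_neq0_poweRD_def.
have /andP[/eqP -> /eqP ->] : (a == 0%R) && (b == 0%R).
  by rewrite -paddr_eq0// ab.
by rewrite addr0 !poweRe0 mule1.
Qed.

Lemma poweR_prod (I : Type) (r : seq I) (F : I -> \bar R) (t : R) :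
  (forall i, 0 <= F i) ->
  (\prod_(i <- r) F i) `^ t = \prod_(i <- r) F i `^ t.
Proof.
move=> F0; elim: r => [|i r IH]; first by rewrite !big_nil poweR1r.
by rewrite !big_cons poweRM ?IH//; exact: prode_ge0.
Qed.

Lemma lee_prod (I : Type) (r : seq I) (F G : I -> \bar R) :
  (forall i, 0 <= F i) -> (forall i, F i <= G i) ->
  \prod_(i <- r) F i <= \prod_(i <- r) G i.
Proof.
move=> F0 FG; elim: r => [|i r IH]; first by rewrite !big_nil.
by rewrite !big_cons lee_pmul//; exact: prode_ge0.
Qed.

Lemma prod_EFinM (I : Type) (r : seq I) (C : I -> R) (F : I -> \bar R) :
  \prod_(i <- r) ((C i)%:E * F i) = (\prod_(i <- r) C i)%R%:E * \prod_(i <- r) F i.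
Proof.
elim: r => [|i r IH]; first by rewrite !big_nil mule1.
by rewrite !big_cons IH muleACA.
Qed.

End ereal_power.

Lemma eq_iint_in (R : realType) (E : vectType R) (W : {vspace E}) b
    (F G : E -> \bar R) x :
  {subset b <= W} -> (forall y, y \in W -> F y = G y) -> x \in W ->
  iint b F x = iint b G x.
Proof.
move=> bW FG; elim: b x bW => [|v b IH] x bW xW /=; first exact: FG.
apply: eq_integral => s _; apply: IH.
  by move=> u ub; apply: bW; rewrite in_cons ub orbT.
by rewrite memvD// memvZ// bW// mem_head.
Qed.

Lemma iint_dim0 (R : realType) (E : vectType R) (U : {vspace E}) (F : E -> \bar R) x :
  \dim U = 0%N -> iint (vbasis U) F x = F x.
Proof. by move=> U0; have /size0nil -> : size (vbasis U) = 0%N by rewrite size_tuple. Qed.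

Lemma dim_limg_le (K : fieldType) (E E' : vectType K) (l : 'Hom(E, E')) (U : {vspace E}) :
  (\dim (l @: U)%VS <= \dim U)%N.
Proof. by rewrite -[leqRHS](limg_ker_dim l U) leq_addl. Qed.

Section feasible.
Variables (R : realType) (E : vectType R) (J : finType) (H : J -> vectType R).
Implicit Types (U V W : {vspace E}) (l : forall j, 'Hom(E, H j)) (th : J -> R).

(** The finiteness conditions of Bennett, Carbery, Christ and Tao for the maps restricted to [U].
    Varying a subspace of a fixed [E] keeps the induction on dimension inside one ambient space. *)
Definition feasible U l th := [/\ forall j, 0 <= th j <= 1,
  (\dim U)%:R = \sum_j th j * (\dim (l j @: U)%VS)%:R &
  forall V, (V <= U)%VS -> (\dim V)%:R <= \sum_j th j * (\dim (l j @: V)%VS)%:R].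

Definition critical l th V := (\dim V)%:R = \sum_j th j * (\dim (l j @: V)%VS)%:R.

(** The exponents sit on the functions, so only plain integrals occur on the right. The arbitrary
    bases [vbasis] affect [C] but not its existence. *)
Definition BL_finite U l th := exists C : R, 0 < C /\
  forall f : (forall j, H j -> \bar R),
  (forall j, vmeas (f j)) -> (forall j y, (0 <= f j y)%E) ->
  (iint (vbasis U) (fun x => \prod_j f j (l j x) `^ th j) 0%R <=
   C%:E * \prod_j (iint (vbasis (l j @: U)%VS) (f j) 0%R) `^ th j)%E.

Lemma BL_finite_dim0 U l th : \dim U = 0%N -> BL_finite U l th.
Proof.
move=> U0; exists 1; split => // f mf f0; rewrite iint_dim0// mul1e.
apply: lee_prod => j; first exact: poweR_ge0.
rewrite iint_dim0 ?linear0//.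
by apply/eqP; rewrite -leqn0 -U0; exact: dim_limg_le.
Qed.

(** The integrand for [th] is the [t]-weighted geometric mean of those for [th1] and [th2], so
    Hoelder applies; the right-hand sides combine in the same way. *)
Lemma BL_finite_interp U l th th1 th2 (t : R) : 0 < t < 1 ->
  (forall j, 0 <= th1 j) -> (forall j, 0 <= th2 j) ->
  (forall j, th j = t * th1 j + (1 - t) * th2 j) ->
  BL_finite U l th1 -> BL_finite U l th2 -> BL_finite U l th.
Proof.
move=> t01 p1 p2 thE [C1 [C10 H1]] [C2 [C20 H2]].
have /andP[t0 t1] := t01; have t1' : 0 < 1 - t by rewrite subr_gt0.
exists (C1 `^ t * C2 `^ (1 - t)); split; first by rewrite mulr_gt0// powR_gt0.
move=> f mf f0; have split_prod (x : forall j, \bar R) : (forall j, (0 <= x j)%E) ->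
    (\prod_j x j `^ th j =
     (\prod_j x j `^ th1 j) `^ t * (\prod_j x j `^ th2 j) `^ (1 - t))%E.
  move=> x0; rewrite !poweR_prod//; try (by move=> j; exact: poweR_ge0).
  rewrite -big_split /=; apply: eq_bigr => j _.
  rewrite thE poweRD_ge0 ?mulr_ge0 ?(ltW t0) ?(ltW t1')//.
  by rewrite mulrC poweRrM [X in (_ * _ `^ X)%E]mulrC poweRrM.
have pw0 (th' : J -> R) z : (0 <= \prod_j f j (l j z) `^ th' j)%E.
  by apply: prode_ge0 => j _; exact: poweR_ge0.
have mpw (th' : J -> R) : vmeas (fun z => \prod_j f j (l j z) `^ th' j)%E.
  exact: vmeas_prod_poweR.
under eq_iint do rewrite split_prod//.
apply: le_trans; first exact: hoelder_iint.
have i0 j : (0 <= iint (vbasis (l j @: U)%VS) (f j) 0%R)%E by exact: iint_ge0.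
rewrite split_prod// EFinM -!poweR_EFin muleACA -!poweRM ?lee_fin ?(ltW C10) ?(ltW C20)//;
  try (by apply: prode_ge0 => j _; exact: poweR_ge0).
apply: lee_pmul; try exact: poweR_ge0.
- apply: gt0_ler_poweR; rewrite ?(ltW t0)//= ?in_itv/= ?leey ?andbT//.
  + by rewrite iint_ge0.
  + by rewrite mule_ge0 ?lee_fin ?(ltW C10)//; apply: prode_ge0 => j _; exact: poweR_ge0.
  + exact: H1.
- apply: gt0_ler_poweR; rewrite ?(ltW t1')//= ?in_itv/= ?leey ?andbT//.
  + by rewrite iint_ge0.
  + by rewrite mule_ge0 ?lee_fin ?(ltW C20)//; apply: prode_ge0 => j _; exact: poweR_ge0.
  + exact: H2.
Qed.

(** On [U] the map [l j] is injective, so its factor is a linear change of variables, while every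
    other factor is constant. *)
Lemma BL_finite_base U l th j : th j = 1 -> (U :&: lker (l j) = 0)%VS ->
  (forall k, k != j -> th k = 0 \/ \dim (l k @: U)%VS = 0%N) -> BL_finite U l th.
Proof.
move=> thj inj triv.
have bas : basis_of (l j @: U)%VS (map (l j) (vbasis U)).
  by apply: limg_basis_of => //; exact: vbasisP.
have [C [C0 HC]] := iint_basis bas (vbasisP (l j @: U)%VS).
exists C; split => // f mf f0.
(* [K] collects the other factors: on [U] each has exponent 0 or argument [l k y = 0]. *)
pose K := (\prod_(k | k != j) f k 0%R `^ th k)%E.
have K0 : (0 <= K)%E by apply: prode_ge0 => k _; exact: poweR_ge0.
have -> : (\prod_j0 iint (vbasis (l j0 @: U)%VS) (f j0) 0%R `^ th j0 =
    iint (vbasis (l j @: U)%VS) (f j) 0%R * K)%E.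
  rewrite (bigD1 j)//= thj poweRe1 ?iint_ge0//; congr (_ * _)%E.
  apply: eq_bigr => k /triv[->|U0]; first by rewrite !poweRe0.
  by rewrite iint_dim0.
rewrite (@eq_iint_in _ _ U _ _ (fun x => K * f j (l j x))%E); last 3 first.
- by move=> u ub; rewrite -[U](span_basis (vbasisP U)) memv_span.
- move=> y yU; rewrite (bigD1 j)//= thj poweRe1// muleC; congr (_ * _)%E.
  apply: eq_bigr => k /triv[->|U0]; first by rewrite !poweRe0.
  suff -> : l k y = 0 by [].
  apply/eqP; rewrite -memv0; move/eqP: U0; rewrite dimv_eq0 => /eqP <-.
  exact: memv_img.
- exact: mem0v.
rewrite iintZ//; last by apply: vmeas_hom.
rewrite [(_ * K)%E]muleC muleCA; apply: lee_wpmul2l => //.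
by rewrite iint_hom linear0; exact: HC.
Qed.

(** A model inside [H j] of the map into the quotient by [l j @: V]: the component in [l j @: V] is
    removed. *)
Definition quotient_map l V j : 'Hom(E, H j) :=
  ((\1%VF - projv (l j @: V)%VS)%R \o l j)%VF.

Lemma quotient_mapE l V j x :
  l j x - quotient_map l V j x \in (l j @: V)%VS.
Proof.
rewrite /quotient_map comp_lfunE add_lfunE opp_lfunE id_lfunE subKr.
exact: memv_proj.
Qed.

(** Rank-nullity on [l j @: (W + V)] for the projection that removes the component in [l j @: V]. *)
Lemma dim_quotient_map l V j W :
  (\dim (quotient_map l V j @: W)%VS + \dim (l j @: V)%VS =
   \dim (l j @: (W + V))%VS)%N.
Proof.
set pi := (\1%VF - projv (l j @: V)%VS)%R : 'End(H j).
have piV y : (y \in lker pi) = (y \in l j @: V)%VS.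
  rewrite memv_ker /pi add_lfunE opp_lfunE id_lfunE subr_eq0.
  apply/idP/idP => [/eqP ->|yV]; first exact: memv_proj.
  by rewrite projv_id.
have -> : (quotient_map l V j @: W = pi @: (l j @: (W + V)))%VS.
  rewrite limg_comp limgD limgD -[LHS]addv0; congr (_ + _)%VS.
  by apply/esym/eqP; rewrite -lkerE; apply/subvP => y; rewrite piV.
rewrite -(limg_ker_dim pi (l j @: (W + V))%VS) addnC; congr (\dim _ + _)%N.
apply/esym/vspaceP => y; rewrite memv_cap piV.
by rewrite andb_idl// => yV; apply: subvP yV; rewrite limgS// addvSr.
Qed.

(** Tonelli: the estimate on [V] bounds the integral over each coset of [V] by functions on the
    quotients, to which the estimate on the complement [W] applies. *)
Lemma BL_finite_factor U V l th : (V <= U)%VS -> (forall j, 0 <= th j) ->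
  BL_finite V l th -> BL_finite (U :\: V)%VS (quotient_map l V) th ->
  BL_finite U l th.
Proof.
move=> VU th0 [C1 [C10 H1]] [C2 [C20 H2]]; set W := (U :\: V)%VS in H2.
have WVU : (W + V = U)%VS by rewrite addv_diff; apply/addv_idPl.
have basWV (H' : vectType R) (A B D : {vspace H'}) : (A + B = D)%VS ->
    (\dim A + \dim B = \dim D)%N -> basis_of D (vbasis A ++ vbasis B).
  move=> ABD dAB; apply/andP; split.
    by rewrite span_cat !(span_basis (vbasisP _)) ABD.
  by rewrite /free span_cat !(span_basis (vbasisP _)) ABD size_cat !size_tuple dAB.
have [C3 [C30 H3]] : exists C : R, 0 < C /\ forall F x, vmeas F -> (forall y, 0 <= F y)%E ->
    (iint (vbasis U) F x <= C%:E * iint (vbasis W ++ vbasis V) F x)%E.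
  apply: (iint_basis (vbasisP U)); apply: basWV => //.
  by rewrite -(dimv_cap_compl U V) addnC; congr (\dim _ + _)%N; apply/esym/capv_idPr.
have /choice[C4 H4] : forall j, exists C : R, 0 < C /\ forall F x, vmeas F -> (forall y, 0 <= F y)%E ->
    (iint (vbasis (quotient_map l V j @: W)%VS ++ vbasis (l j @: V)%VS) F x <=
     C%:E * iint (vbasis (l j @: U)%VS) F x)%E.
  move=> j; apply: (iint_basis _ (vbasisP _)); apply: basWV; last first.
    by rewrite dim_quotient_map WVU.
  apply/eqP; rewrite eqEdim; apply/andP; split.
    rewrite subv_add (limgS _ VU) andbT; apply/subvP => _ /memv_imgP[w wW ->].
    rewrite -(subKr (l j w) (quotient_map l V j w)) memvB//.
      by rewrite memv_img// (subvP (diffvSl U V)).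
    exact: subvP (limgS _ VU) _ (quotient_mapE _ _ _ _).
  rewrite -WVU -dim_quotient_map dimv_disjoint_sum//.
  apply/eqP; rewrite -subv0; apply/subvP => y; rewrite memv_cap memv0.
  move=> /andP[/memv_imgP[w wW ->]].
  rewrite /quotient_map comp_lfunE add_lfunE opp_lfunE id_lfunE => yV.
  rewrite subr_eq0 eq_sym; apply/eqP/projv_id.
  by rewrite -(subrK (projv (l j @: V)%VS (l j w)) (l j w)) memvD// memv_proj.
exists (C3 * (C1 * C2) * \prod_j C4 j `^ th j); split.
  by rewrite !mulr_gt0//; apply: prodr_gt0 => j _; rewrite powR_gt0//; case: (H4 j).
move=> f mf f0.
set G := fun x => (\prod_j f j (l j x) `^ th j)%E.
have G0 x : (0 <= G x)%E by apply: prode_ge0 => j _; exact: poweR_ge0.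
have mG : vmeas G.
  exact: vmeas_prod_poweR.
apply: (le_trans (H3 _ _ mG G0)).
rewrite iint_cat !EFinM -!muleA; apply: lee_wpmul2l; first by rewrite lee_fin ltW.
(* Integrating over cosets of [l j @: V] makes [g j] a function on the quotient, as [gE] records. *)
pose g j := iint (vbasis (l j @: V)%VS) (f j).
have g0 j y : (0 <= g j y)%E by exact: iint_ge0.
have mg j : vmeas (g j) by exact: vmeas_iint.
have gE j x : g j (quotient_map l V j x) = g j (l j x).
  rewrite -[l j x](subrK (quotient_map l V j x)) addrC /g iint_invariant//.
  by rewrite (span_basis (vbasisP _)) quotient_mapE.
(* The estimate on [V] is applied to the translates [f j (l j x + y)]. *)
have inner x : (iint (vbasis V) G x <=
    C1%:E * \prod_j g j (quotient_map l V j x) `^ th j)%E.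
  rewrite -[x in leLHS]addr0 iint_shift.
  have := H1 (fun j y => f j (l j x + y)) (fun j => vmeas_shift (l j x) (mf j)) (fun j y => f0 j _).
  congr (_ <= _)%E.
    by apply: eq_iint => y; apply: eq_bigr => j _; rewrite linearD.
  congr (_ * _)%E; apply: eq_bigr => j _; congr (_ `^ _)%E.
  by rewrite gE -iint_shift addr0.
set G' := fun x => (\prod_j g j (quotient_map l V j x) `^ th j)%E in inner.
have G'0 x : (0 <= G' x)%E by apply: prode_ge0 => j _; exact: poweR_ge0.
have mG' : vmeas G'.
  exact: vmeas_prod_poweR.
apply: (@le_trans _ _ (C1%:E * iint (vbasis W) G' 0%R)%E).
  rewrite -iintZ//; last by rewrite lee_fin ltW.
  apply: iint_le => //.
  - exact: vmeas_iint.
  - by apply: vmeasM => //; exact: vmeas_cst.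
  - by move=> y; exact: iint_ge0.
apply: lee_wpmul2l; first by rewrite lee_fin ltW.
apply: (le_trans (H2 g mg g0)); apply: lee_wpmul2l; first by rewrite lee_fin ltW.
rewrite -prodEFin -big_split /=; apply: lee_prod => j; first exact: poweR_ge0.
have [C4j0 H4j] := H4 j.
rewrite -poweR_EFin -poweRM ?lee_fin ?(ltW C4j0) ?iint_ge0//.
apply: gt0_ler_poweR; rewrite ?th0//= ?in_itv/= ?leey ?andbT//.
- by rewrite iint_ge0.
- by rewrite mule_ge0 ?iint_ge0// lee_fin ltW.
- by rewrite /g -iint_cat; exact: H4j.
Qed.

Lemma feasible_restrict U V l th : (V <= U)%VS -> feasible U l th ->
  critical l th V -> feasible V l th.
Proof.
by move=> VU [? _ H2] cV; split => // V' V'V; apply: H2; exact: subv_trans VU.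
Qed.

(** Subtracting the equality for the critical [V] from the conditions on [U] and on [W + V] leaves
    the conditions for the quotient. *)
Lemma feasible_quotient U V l th : (V <= U)%VS -> feasible U l th ->
  critical l th V -> feasible (U :\: V)%VS (quotient_map l V) th.
Proof.
move=> VU [H0 H1 H2] cV; split => //.
  have := dimv_cap_compl U V.
  rewrite (capv_idPr VU) => /(congr1 (fun k => k%:R : R)); rewrite natrD H1 cV.
  move/(canRL (addKr _)) => ->; rewrite addrC -sumrB; apply: eq_bigr => j _.
  have := dim_quotient_map l V j (U :\: V); rewrite addv_diff (addv_idPl VU) => <-.
  by rewrite natrD mulrDr addrK.
move=> W WUV; rewrite -(lerD2r (\dim V)%:R) [X in _ <= _ + X]cV -big_split /=.
under eq_bigr do rewrite -mulrDr -natrD dim_quotient_map.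
rewrite -natrD -dimv_disjoint_sum; last first.
  apply/eqP; rewrite -subv0 -(capv_diff U V); exact: capvS.
apply: H2; rewrite subv_add VU andbT; exact: subv_trans (diffvSl U V).
Qed.

End feasible.

(** * Tilting the exponents *)

(** Supplies a minimum over infinitely many subspaces of a quantity that depends only on finitely
    many bounded dimensions. *)
Lemma finite_range_argmin (R : realType) (X : Type) (K : finType) (code : X -> K)
    (h : X -> R) (P : set X) :
  (forall x y, code x = code y -> h x = h y) -> P !=set0 ->
  exists2 x, P x & forall y, P y -> h x <= h y.
Proof.
move=> hc [x0 Px0].
pose Q c := `[< exists2 x, P x & code x = c >].
have /choice[rep repP] : forall c, exists x, Q c -> P x /\ code x = c.
  move=> c.
  by have [/asboolP[x Px xc]|nQ] := boolP (Q c); [exists x|exists x0].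
have Qx0 : Q (code x0) by apply/asboolP; exists x0.
case: (@arg_minP _ _ _ (code x0) Q (fun c => h (rep c)) Qx0) => c Qc cmin.
exists (rep c); first by have [] := repP _ Qc.
move=> y Py; have Qy : Q (code y) by apply/asboolP; exists y.
by rewrite (le_trans (cmin _ Qy))// (hc _ y)//; have [] := repP _ Qy.
Qed.

Section core.
Variables (R : realType) (E : vectType R) (J : finType) (H : J -> vectType R).
Implicit Types (U V W : {vspace E}) (l : forall j, 'Hom(E, H j)) (th : J -> R).

Local Notation rdim V := ((\dim V)%:R : R).

(* Moves weight from [k] to [j] while preserving the scaling identity on [U]. *)
Definition tilt l U th j k (t : R) i :=
  th i + t * ((i == j)%:R * rdim (l k @: U)%VS - (i == k)%:R * rdim (l j @: U)%VS).

Lemma sum_tilt l U th j k t V :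
  \sum_i tilt l U th j k t i * rdim (l i @: V)%VS =
  \sum_i th i * rdim (l i @: V)%VS +
  t * (rdim (l k @: U)%VS * rdim (l j @: V)%VS - rdim (l j @: U)%VS * rdim (l k @: V)%VS).
Proof.
have pick (i0 : J) (c : R) (g : J -> R) : \sum_i (i == i0)%:R * c * g i = c * g i0.
  rewrite (bigD1 i0)//= eqxx mul1r big1 ?addr0// => i /negPf ->.
  by rewrite !mul0r.
rewrite -(pick j _ (fun i => rdim (l i @: V)%VS)) -(pick k _ (fun i => rdim (l i @: V)%VS)).
rewrite -sumrB mulr_sumr -big_split /=; apply: eq_bigr => i _.
by rewrite /tilt; ring.
Qed.

Definition nfrac th := #|[set j | 0 < th j < 1]%SET|.

(** As [t] grows from 0, either an exponent reaches 0 or 1 first, or the constraint of some subspace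
    becomes tight before; stopping at that moment keeps feasibility. *)
Lemma tilt_tight U l th j k : feasible U l th ->
  (forall V, (V <= U)%VS -> critical l th V -> \dim V = 0%N \/ V = U) ->
  j != k -> 0 < th j < 1 -> 0 < th k < 1 ->
  (0 < \dim (l j @: U)%VS)%N -> (0 < \dim (l k @: U)%VS)%N ->
  exists2 t, 0 < t & feasible U l (tilt l U th j k t) /\
    ((nfrac (tilt l U th j k t) < nfrac th)%N \/
     exists V, [/\ (V <= U)%VS, \dim V != 0%N, V != U & critical l (tilt l U th j k t) V]).
Proof.
move=> [H0 H1 H2] nocrit jk /andP[j0 j1] /andP[k0 k1] dj dk.
set a := rdim (l j @: U)%VS; set b := rdim (l k @: U)%VS.
have a0 : 0 < a by rewrite ltr0n.
have b0 : 0 < b by rewrite ltr0n.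
(* The first time at which [th j] reaches 1 or [th k] reaches 0. *)
pose t0 := Num.min ((1 - th j) / b) (th k / a).
have t00 : 0 < t0 by rewrite lt_min !divr_gt0// subr_gt0.
(* [S V] is the slack in the constraint for [V] at time 0, and [be V] its rate of change under the
   tilt. *)
pose S V := \sum_i th i * rdim (l i @: V)%VS - rdim V.
pose be V := b * rdim (l j @: V)%VS - a * rdim (l k @: V)%VS.
have tiltj t : tilt l U th j k t j = th j + t * b.
  by rewrite /tilt eqxx (negPf jk) mul1r mul0r subr0.
have tiltk t : tilt l U th j k t k = th k - t * a.
  by rewrite /tilt eqxx eq_sym (negPf jk) mul1r mul0r sub0r mulrN.
have tilti t i : i != j -> i != k -> tilt l U th j k t i = th i.
  by move=> /negPf ij /negPf ik; rewrite /tilt ij ik !mul0r subr0 mulr0 addr0.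
have box t : 0 <= t -> t <= t0 -> forall i, 0 <= tilt l U th j k t i <= 1.
  move=> tp; rewrite le_min ler_pdivlMr// ler_pdivlMr// => /andP[tj tk] i.
  have [->|ij] := eqVneq i j.
    by rewrite tiltj addr_ge0 ?mulr_ge0 ?(ltW j0) ?(ltW b0)//= addrC -lerBrDr.
  have [->|ik] := eqVneq i k.
    by rewrite tiltk subr_ge0 tk/= lerBlDr (le_trans (ltW k1))// lerDl mulr_ge0// ltW.
  by rewrite tilti.
have S0 V : (V <= U)%VS -> 0 <= S V by move=> VU; rewrite subr_ge0 H2.
have SE t V : \sum_i tilt l U th j k t i * rdim (l i @: V)%VS = rdim V + (S V + t * be V).
  by rewrite sum_tilt /S /be -/a -/b; ring.
have beU : be U = 0 by rewrite /be mulrC subrr.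
have SU : S U = 0 by rewrite /S -H1 subrr.
have feas t : 0 <= t -> t <= t0 ->
    (forall V, (V <= U)%VS -> 0 <= S V + t * be V) -> feasible U l (tilt l U th j k t).
  move=> tp tt0 hV; split; first exact: box.
    by rewrite SE beU SU mulr0 !addr0.
  by move=> V VU; rewrite SE lerDl hV.
have [good|/existsNP[V /not_implyP[VU /negP]]] :=
    pselect (forall V, (V <= U)%VS -> 0 <= S V + t0 * be V).
  exists t0 => //; split; first exact: feas (ltW t00) (lexx _) good.
  left; apply: proper_card; apply/properP; split.
    apply/fintype.subsetP => i; rewrite !inE.
    have [->|ij] := eqVneq i j; first by rewrite j0 j1.
    have [->|ik] := eqVneq i k; first by rewrite k0 k1.
    by rewrite tilti.
  have [h|h] := leP ((1 - th j) / b) (th k / a).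
    exists j; rewrite !inE ?j0 ?j1// tiltj /t0 (min_idPl h) divfK ?gt_eqF//.
    by rewrite addrC subrK ltxx andbF.
  exists k; rewrite !inE ?k0 ?k1// tiltk /t0 (min_idPr (ltW h)) divfK ?gt_eqF//.
  by rewrite subrr ltxx.
rewrite -ltNge => badV.
pose N := (\dim {:E}).+1.
(* [code] records all dimensions that [S] and [be] depend on. For decreasing slack, [rho V] is the
   time at which the constraint becomes tight. *)
pose code V : {ffun J -> 'I_N} * 'I_N := ([ffun i => inord (\dim (l i @: V)%VS)], inord (\dim V)).
pose rho V := S V / - be V.
pose P := [set V | (V <= U)%VS /\ be V < 0].
have PV : P V.
  split => //; rewrite ltNge; apply/negP => beV.
  by move: badV; rewrite ltNge addr_ge0 ?S0// mulr_ge0// ltW.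
have dimN W : (\dim W < N)%N by rewrite ltnS dimvS// subvf.
have dimlN W i : (\dim (l i @: W)%VS < N)%N by rewrite (leq_ltn_trans (dim_limg_le _ _)).
have codeP V1 V2 : code V1 = code V2 -> rho V1 = rho V2.
  move=> [/ffunP c1 c2].
  have e i : \dim (l i @: V1)%VS = \dim (l i @: V2)%VS.
    by have := c1 i; rewrite !ffunE => /(congr1 val); rewrite /= !inordK.
  have e' : \dim V1 = \dim V2 by move/(congr1 val): c2; rewrite /= !inordK.
  rewrite /rho /S /be !e e'; congr ((_ - _) / _).
  by apply: eq_bigr => i _; rewrite e.
have [V0 [V0U beV0] V0min] := finite_range_argmin codeP (ex_intro _ V PV).
have rhoV : rho V < t0.
  by rewrite /rho ltr_pdivrMr ?oppr_gt0 ?PV.2// mulrN -subr_lt0 opprK.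
have crit0 W : \dim W = 0%N -> be W = 0.
  move=> W0; have e i : \dim (l i @: W)%VS = 0%N.
    by apply/eqP; rewrite -leqn0 -W0; exact: dim_limg_le.
  by rewrite /be !e !mulr0 subrr.
have V00 : \dim V0 != 0%N by apply: contraTneq beV0 => /crit0 ->; rewrite ltxx.
have V0nU : V0 != U by apply: contraTneq beV0 => ->; rewrite beU ltxx.
(* The minimizer has positive slack at time 0: otherwise it would be critical, hence zero or [U],
   where [be] vanishes. *)
have rho0 : 0 < rho V0.
  rewrite divr_gt0 ?oppr_gt0// lt_neqAle S0// andbT eq_sym; apply/negP => /eqP SV0.
  have /nocrit[//|V0z|V0e] : critical l th V0 by apply/eqP; rewrite eq_sym -subr_eq0 -/(S V0) SV0.
    by rewrite V0z in V00.
  by rewrite V0e eqxx in V0nU.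
have rt0 : rho V0 <= t0 by rewrite (le_trans (V0min _ PV))// ltW.
exists (rho V0) => //; split.
  apply: feas => //; first exact: ltW.
  move=> W WU; have [beW|beW] := leP 0 (be W).
    by rewrite addr_ge0 ?S0// mulr_ge0// ltW.
  have := V0min W (conj WU beW); rewrite [rho W]/rho ler_pdivlMr ?oppr_gt0//.
  by rewrite mulrN -subr_ge0 opprK.
right; exists V0; split => //.
rewrite /critical SE /rho; have : be V0 != 0 by rewrite lt_eqF.
by move=> n0; field.
Qed.

(** Lexicographic induction on [\dim U] and then on the number of exponents strictly between 0 and
    1. *)
Theorem feasible_BL_finite U l th : feasible U l th -> BL_finite U l th.
Proof.
have [d Ud] := ubnP (\dim U); elim: d U l th Ud => // d IHd U l th Ud.
have [q qf] := ubnP (nfrac th); elim: q th qf => // q IHq th thq feas.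
have [H0 H1 H2] := feas; have th0 i : 0 <= th i by case/andP: (H0 i).
have [U0|U0] := eqVneq (\dim U) 0%N; first exact: BL_finite_dim0.
(* A proper nonzero critical [V] leaves two problems of smaller dimension, on [V] and on its
   complement in [U]. *)
have factor th' V : feasible U l th' -> (V <= U)%VS -> \dim V != 0%N -> V != U ->
    critical l th' V -> BL_finite U l th'.
  move=> feas' VU V0 VnU cV; have VltU : (\dim V < \dim U)%N.
    rewrite ltn_neqAle dimvS// andbT; apply: contra VnU => /eqP VdU.
    by rewrite eqEdim VU VdU/=.
  have VWU := dimv_cap_compl U V; rewrite (capv_idPr VU) in VWU.
  apply: (BL_finite_factor VU); first by move=> i; have [h _ _] := feas'; case/andP: (h i).
    by apply: IHd (feasible_restrict VU feas' cV); exact: leq_trans VltU _.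
  apply: IHd (feasible_quotient VU feas' cV).
  by rewrite -ltnS (leq_trans _ Ud)// ltnS -VWU -[ltnLHS]add0n ltn_add2r lt0n.
have [[V [VU V0 VnU cV]]|nocrit] := pselect (exists V,
    [/\ (V <= U)%VS, \dim V != 0%N, V != U & critical l th V]).
  exact: factor cV.
have {}nocrit V : (V <= U)%VS -> critical l th V -> \dim V = 0%N \/ V = U.
  move=> VU cV; have [|V0] := eqVneq (\dim V) 0%N; first by left.
  have [|VnU] := eqVneq V U; first by right.
  by exfalso; apply: nocrit; exists V; split.
have [[j [thj dj]]|no1] := pselect (exists j, th j = 1 /\ (0 < \dim (l j @: U)%VS)%N).
  set V := (U :&: lker (l j))%VS; have VU : (V <= U)%VS by exact: capvSl.
  have dimV := limg_ker_dim (l j) U; rewrite -/V in dimV.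
  have lV : \dim (l j @: V)%VS = 0%N.
    by apply/eqP; rewrite dimv_eq0 -lkerE capvSr.
  pose rest W := \sum_(k | k != j) th k * rdim (l k @: W)%VS.
  have restE W : \sum_k th k * rdim (l k @: W)%VS = rdim (l j @: W)%VS + rest W.
    by rewrite (bigD1 j)//= thj mul1r.
  have restU : rest U = rdim V.
    by apply: (addrI (rdim (l j @: U)%VS)); rewrite -restE -H1 -dimV natrD addrC.
  (* By scaling the other maps contribute exactly [\dim V] on [U], hence at most that on [V], while
     [l j] contributes nothing there. *)
  have cV : critical l th V.
    apply/le_anti; rewrite H2//= restE lV add0r -restU.
    apply: ler_sum => k _; rewrite ler_wpM2l// ler_nat dimvS// limgS//.
  have V0 : \dim V = 0%N.
    have [//|VU'] := nocrit V VU cV.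
    by move: dj; rewrite lt0n -lV VU' eqxx.
  apply: (BL_finite_base thj); first by apply/eqP; rewrite -dimv_eq0 -/V V0.
  (* With [V] zero, the nonnegative contributions of the other maps sum to zero, so each
     vanishes. *)
  move=> k kj; have := restU; rewrite V0 => /eqP.
  rewrite psumr_eq0; last by move=> i _; rewrite mulr_ge0.
  move=> /allP/(_ k (mem_index_enum _))/implyP/(_ kj).
  rewrite mulf_eq0 pnatr_eq0 => /orP[/eqP|/eqP]; [by left|by right].
have frac j : 0 < th j * rdim (l j @: U)%VS -> 0 < th j < 1 /\ (0 < \dim (l j @: U)%VS)%N.
  move=> p; have dj : (0 < \dim (l j @: U)%VS)%N.
    by rewrite lt0n; apply: contraTneq p => ->; rewrite mulr0 ltxx.
  have tj : 0 < th j by move: p; rewrite pmulr_lgt0// ltr0n.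
  split => //; rewrite tj /= lt_neqAle; have /andP[_ ->] := H0 j; rewrite andbT.
  by apply/negP => /eqP tj1; apply: no1; exists j.
have pos i : 0 <= th i * rdim (l i @: U)%VS by rewrite mulr_ge0.
have [j pj] : exists j, 0 < th j * rdim (l j @: U)%VS.
  apply: contrapT => /forallNP none; move: H1; rewrite big1.
    by move/eqP; rewrite pnatr_eq0 (negPf U0).
  by move=> j _; apply/le_anti; rewrite pos andbT leNgt; apply/negP/none.
have [fj dj] := frac _ pj.
(* One map cannot carry the scaling identity alone: its weight is below 1 and its rank at most
   [\dim U]. *)
have [k [kj pk]] : exists k, k != j /\ 0 < th k * rdim (l k @: U)%VS.
  apply: contrapT => /forallNP none; move: H1; rewrite (bigD1 j)//= big1 ?addr0; last first.
    move=> k kj; apply/le_anti; rewrite pos andbT leNgt; apply/negP => pk.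
    by apply: (none k).
  move=> e; have := dim_limg_le (l j) U; rewrite -(ler_nat R) e.
  rewrite leNgt gtr_pMl ?ltr0n//; by case/andP: fj => _ ->.
have [fk dk] := frac _ pk.
have jk : j != k by rewrite eq_sym.
have [t1 t10 [fe1 alt1]] := tilt_tight feas nocrit jk fj fk dj dk.
have [t2 t20 [fe2 alt2]] := tilt_tight feas nocrit kj fk fj dk dj.
have solve th' : feasible U l th' -> ((nfrac th' < nfrac th)%N \/ exists V,
    [/\ (V <= U)%VS, \dim V != 0%N, V != U & critical l th' V]) -> BL_finite U l th'.
  move=> fe' [lt|[V [VU V0 VnU cV]]]; last exact: factor cV.
  by apply: IHq fe'; exact: leq_trans lt _.
have s0 : 0 < t1 + t2 by rewrite addr_gt0.
(* The two tilts displace [th] by [t1] and [t2] in opposite directions, so these weights average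
   them back to [th]. *)
apply: (@BL_finite_interp _ _ _ _ U l th (tilt l U th j k t1) (tilt l U th k j t2) (t2 / (t1 + t2))).
- by rewrite divr_gt0//= ltr_pdivrMr// mul1r ltrDr.
- by move=> i; have [h _ _] := fe1; case/andP: (h i).
- by move=> i; have [h _ _] := fe2; case/andP: (h i).
- by move=> i; rewrite /tilt; have : t1 + t2 != 0 by [rewrite gt_eqF]; move=> n0; field.
- exact: solve.
- exact: solve.
Qed.

End core.

(** * Lebesgue measure of a Hilbert space *)

Lemma wmeas_sum (R : realType) (E : vectType R) d (T : measurableType d) (I : Type)
    (r : seq I) (g : I -> T -> E) :
  (forall i, wmeas (g i)) -> wmeas (fun t => \sum_(i <- r) g i t).
Proof.
move=> mg; elim: r => [|i r IH].
  by under eq_fun do rewrite big_nil; exact: wmeas_cst.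
by under eq_fun do rewrite big_cons; exact: wmeasD.
Qed.

(** [tuple_lebesgue] is bundled only as a measure; its sigma-finiteness is proved separately and
    packed into the structure here. *)
Lemma tonelli_sigma_finite d1 d2 (T1 : measurableType d1) (T2 : measurableType d2)
    (R : realType) (m1 : {measure set T1 -> \bar R})
    (m2 : {sigma_finite_measure set T2 -> \bar R}) (f : T1 * T2 -> \bar R) :
  sigma_finite setT m1 -> measurable_fun setT f -> (forall p, 0 <= f p)%E ->
  (\int[(m1 \x m2)%E]_p f p = \int[m2]_y \int[m1]_x f (x, y))%E.
Proof.
move=> sf1 mf f0.
pose H2 := isSFinite.Build _ _ _ _ (sfinite_measure_sigma_finite sf1).
pose H3 := isSigmaFinite.Build _ _ _ _ sf1.
pose m1' := HB.pack_for (SigmaFiniteMeasure.type T1 R) (Measure.sort m1) H2 H3.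
exact: (@fubini_tonelli2 _ _ _ _ _ m1' m2).
Qed.

Section tuple_lebesgue_integral.
Variable R : realType.
Local Open Scope ereal_scope.

Definition tuple_cube d (r : R) : set (d.-tuple (measurableTypeR R)) :=
  [set t | forall k, (`|tnth t k : R| <= r)%R].

Arguments tuple_cube : clear implicits.

Lemma measurable_tuple_cube d r : measurable (tuple_cube d r).
Proof.
rewrite (_ : tuple_cube d r =
    \bigcap_(k in [set: 'I_d]) (fun t => tnth t k) @^-1` `[(- r)%R : R, r]%classic).
  apply: fin_bigcap_measurable => // k _; rewrite -[X in measurable X]setTI.
  by apply: measurable_tnth => //; exact: measurable_itv.
by apply/seteqP; split => t /= H k; [move=> _|have := H k I]; rewrite /= in_itv/= -ler_norml.
Qed.

Lemma tuple_lebesgue_cube d r : (0 <= r)%R ->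
  tuple_lebesgue R d (tuple_cube d r) = ((2 * r) ^+ d)%:E.
Proof.
move=> r0; elim: d => [|d IH].
  by rewrite /= diracE mem_set ?expr0// => -[].
rewrite /= /pushforward.
have -> : @cons_pair R d @^-1` tuple_cube d.+1 r = tuple_cube d r `*` `[(- r)%R, r]%classic.
  apply/seteqP; split => -[t s] /=; rewrite in_itv/= -ler_norml.
    move=> H; split; last by have := H ord0; rewrite tnth0.
    by move=> k; have := H (lift ord0 k); rewrite tnthS.
  move=> [H1 H2] k; have [j ->|->] := unliftP ord0 k; last by rewrite tnth0.
  by rewrite tnthS; exact: H1.
rewrite product_measure1E//; last exact: measurable_tuple_cube.
rewrite IH [X in _ * X](lebesgue_measure_itv `[(- r)%R, r]) /= lte_fin.
have [r00|r00] := ltP (- r)%R r.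
  by rewrite -EFinD -EFinM exprS mulrC opprK; congr (_ * _)%:E; rewrite mulr2n mulrDl mul1r.
have -> : r = 0%R by apply/le_anti; rewrite r0 andbT; lra.
by rewrite mule0 mulr0 expr0n.
Qed.

Lemma tuple_lebesgue_sigma_finite d : sigma_finite setT (tuple_lebesgue R d).
Proof.
exists (fun n : nat => tuple_cube d n%:R).
  apply/esym/seteqP; split => // t _.
  exists (\max_k Num.bound `|tnth t k : R|%R)%N => // k.
  apply: (le_trans (ltW (archi_boundP (normr_ge0 (tnth t k : R))))).
  by rewrite ler_nat (leq_bigmax k).
move=> n; split; first exact: measurable_tuple_cube.
by rewrite tuple_lebesgue_cube// ltry.
Qed.

(** Tonelli with the head coordinate outermost reproduces the recursion of [iint]; the base point
    [x] varies because the head coordinate moves it. *)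
Lemma integral_tuple_lebesgue (E : vectType R) d (e : d.-tuple E) F x :
  vmeas F -> (forall y, 0 <= F y) ->
  \int[tuple_lebesgue R d]_t F (x + \sum_(k < d) (tnth t k : R) *: tnth e k)%R =
  iint e F x.
Proof.
move=> mF F0.
have mS n (e' : n.-tuple E) y : measurable_fun setT
    (fun t : n.-tuple (measurableTypeR R) => F (y + \sum_(k < n) (tnth t k : R) *: tnth e' k)%R).
  apply: (mF _ _ (fun t : n.-tuple (measurableTypeR R) =>
    y + \sum_(k < n) (tnth t k : R) *: tnth e' k)%R).
  apply: wmeasD; first exact: wmeas_cst.
  by apply: wmeas_sum => k; apply: wmeasZ; exact: measurable_tnth.
elim: d e x => [|d IH] e x.
  rewrite integral_dirac //; last exact: mS.
  rewrite [X in X * _]diracT mul1e big_ord0 addr0.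
  by rewrite tuple0.
case/tupleP: e => v e.
pose f (t : d.+1.-tuple (measurableTypeR R)) :=
  F (x + \sum_(k < d.+1) (tnth t k : R) *: tnth [tuple of v :: e] k)%R.
have mf : measurable_fun setT f by exact: mS.
transitivity (\int[(tuple_lebesgue R d \x @lebesgue_measure R)%E]_p f (cons_pair p)).
  by apply: (ge0_integral_pushforward (@measurable_cons_pair R d)).
rewrite tonelli_sigma_finite//; first last.
- by move=> p; exact: F0.
- by apply: (measurableT_comp mf); exact: measurable_cons_pair.
- exact: tuple_lebesgue_sigma_finite.
apply: eq_integral => s _; apply: etrans (IH e _); apply: eq_integral => t _.
rewrite /f big_ord_recl tnth0 tnth0 addrA; congr (F (_ + _)%R).
by apply: eq_bigr => k _; rewrite !tnthS.
Qed.

End tuple_lebesgue_integral.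

Section hilbert_integral.
Variables (R : realType) (V : hilbert R).

Local Notation d := (\dim {:V}).

Lemma onb_coordE (x : V) : x = \sum_(k < d) coord (onb V) k x *: tnth (onb V) k.
Proof.
rewrite [LHS](coord_basis (onb_basis V) (memvf x)).
by apply: eq_bigr => k _; rewrite (tnth_nth 0).
Qed.

Lemma coord_onb_sum (c : 'I_d -> R) k :
  coord (onb V) k (\sum_(i < d) c i *: tnth (onb V) i) = c k.
Proof.
under eq_bigr do rewrite (tnth_nth 0).
by rewrite coord_sum_free// (basis_free (onb_basis V)).
Qed.

Lemma hnorm_coord (x : V) k : `|coord (onb V) k x| <= hnorm x.
Proof.
rewrite /hnorm -(sqrtr_sqr (coord (onb V) k x)) ler_wsqrtr//.
rewrite {2 3}(onb_coordE x) inner_comb (bigD1 k)//= lerDl.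
by apply: sumr_ge0 => i _; exact: sqr_ge0.
Qed.

Lemma borel_wmeas dT (T : measurableType dT) (g : T -> V) :
  wmeas g -> measurable_fun setT (g : T -> borel V).
Proof.
move=> mg.
pose h (t : T) : d.-tuple (measurableTypeR R) := [tuple coord (onb V) k (g t) | k < d].
rewrite (_ : g = @onb_comb R V \o h); last first.
  apply/funext => t /=; rewrite /onb_comb [LHS]onb_coordE.
  by apply: eq_bigr => k _; rewrite tnth_mktuple.
apply: measurableT_comp; first exact: measurable_onb_comb.
apply/measurable_fun_tnthP => k.
have := mg (linfun (coord (onb V) k : V -> R^o)).
congr measurable_fun; apply/funext => t /=.
by rewrite lfunE /h tnth_mktuple.
Qed.

(** Linear forms are Lipschitz for [hnorm], so preimages of open half-lines are norm-open. *)
Lemma wmeas_borel : wmeas (id : borel V -> V).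
Proof.
move=> phi.
apply: (measurability _ (RGenOInfty.measurableE R)) => _ [_ [a ->] <-].
rewrite setTI; apply: sub_sigma_algebra => x /=; rewrite in_itv/= andbT => ax.
(* A Lipschitz constant for [phi]; the summand 1 keeps it positive. *)
pose K := 1 + \sum_(k < d) `|phi (tnth (onb V) k) : R|.
have K0 : 0 < K by rewrite ltr_pwDl// sumr_ge0.
exists (((phi x : R) - a) / K); first by rewrite divr_gt0// subr_gt0.
move=> y; rewrite ltr_pdivlMr// => yx; rewrite in_itv/= andbT.
have : `|phi (y - x) : R| <= hnorm (y - x) * K.
  rewrite {1}(onb_coordE (y - x)) linear_sum /=.
  apply: (le_trans (ler_norm_sum _ _ _)).
  rewrite /K mulrDr mulr1 mulr_sumr -[leLHS]add0r lerD ?sqrtr_ge0//.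
  by apply: ler_sum => k _; rewrite linearZ normrM ler_wpM2r// hnorm_coord.
rewrite linearB /= => /(fun h => le_lt_trans h yx).
by rewrite ltr_norml => /andP[]; rewrite ltrBrDl opprB addrC subrK.
Qed.

Lemma vmeas_borelP (f : V -> \bar R) :
  measurable_fun setT (f : borel V -> \bar R) <-> vmeas f.
Proof.
split => [mf d' T g mg|mf]; first exact: (measurableT_comp mf (borel_wmeas mg)).
exact: mf wmeas_borel.
Qed.

Lemma integral_hilbert (f : V -> \bar R) : vmeas f -> (forall x, 0 <= f x)%E ->
  (\int[hilbert_lebesgue V]_x f x = iint (onb V) f 0%R)%E.
Proof.
move=> mf f0; rewrite -integral_tuple_lebesgue//.
have mf' := (vmeas_borelP f).2 mf.
rewrite [LHS](ge0_integral_pushforward (@measurable_onb_comb R V))//.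
by apply: eq_integral => t _; rewrite add0r.
Qed.

(** Cubes in the coordinates of [onb V] serve as bounded test sets because their measure is
    explicit. *)
Definition cube (r : R) : set (borel V) := [set x | forall k, `|coord (onb V) k x| <= r].

Lemma measurable_cube r : measurable (cube r).
Proof.
rewrite (_ : cube r =
    \bigcap_(k in [set: 'I_d])
      (fun x : borel V => linfun (coord (onb V) k : V -> R^o) x : measurableTypeR R)
        @^-1` `[- r : R, r]%classic).
  apply: fin_bigcap_measurable => // k _; rewrite -[X in measurable X]setTI.
  by apply: wmeas_borel => //; exact: measurable_itv.
by apply/seteqP; split => x /= H k; [move=> _|have := H k I];
  rewrite /= lfunE /= in_itv/= -ler_norml.
Qed.

Lemma hilbert_lebesgue_cube r : 0 <= r ->
  hilbert_lebesgue V (cube r) = ((2 * r) ^+ d)%:E.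
Proof.
move=> r0; rewrite /= /pushforward -tuple_lebesgue_cube//; congr (tuple_lebesgue R d _).
by apply/seteqP; split => t /= H k; have := H k; rewrite /onb_comb coord_onb_sum.
Qed.

(** The norm with exponent [+oo] is the essential supremum only on a space of positive measure. *)
Lemma hilbert_lebesgue_gt0 : (0 < hilbert_lebesgue V setT)%E.
Proof.
apply: (@lt_le_trans _ _ (hilbert_lebesgue V (cube 1))).
  by rewrite hilbert_lebesgue_cube// lte_fin exprn_gt0// mulr_gt0.
by apply: le_measure; rewrite ?inE//; exact: measurable_cube.
Qed.

End hilbert_integral.

(** * Sufficiency for a single source *)

Lemma measurable_hom (R : realType) (V W : hilbert R) (l : 'Hom(V, W)) :
  measurable_fun setT (l : borel V -> borel W).
Proof. exact: borel_wmeas (wmeas_hom l (@wmeas_borel R V)). Qed.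

Lemma iint_cst0 (R : realType) (E : vectType R) b (x : E) :
  iint b (fun=> 0%E : \bar R) x = 0%E.
Proof. by elim: b x => //= v b IH x; apply: integral0_eq => s _; exact: IH. Qed.

Lemma surj_limg (K : fieldType) (E E' : vectType K) (l : 'Hom(E, E')) :
  (forall y, exists x, l x = y) -> (l @: fullv)%VS = fullv.
Proof.
move=> surj; apply/eqP; rewrite eqEsubv subvf; apply/subvP => y _.
by have [x <-] := surj y; rewrite memv_img// memvf.
Qed.

(** * Null sets under surjective linear maps *)

Section null_preimage.
Variables (R : realType) (V W : hilbert R) (l : 'Hom(V, W)).
Hypothesis surj : forall y, exists x, l x = y.

(** In a basis split between the kernel and a complement, the inner integral of the indicator runs
    over the complement, which [l] maps isomorphically onto [W]; there it vanishes. *)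
Lemma hilbert_null_preimage (N : set (borel W)) : measurable N ->
  hilbert_lebesgue W N = 0%E ->
  hilbert_lebesgue V ((l : borel V -> borel W) @^-1` N) = 0%E.
Proof.
move=> mN N0.
pose F (y : W) : \bar R := (\1_N (y : borel W))%:E.
have mF : vmeas F.
  apply/vmeas_borelP; apply/measurable_EFinP.
  exact: measurable_indic.
have F0 y : (0 <= F y)%E by rewrite lee_fin.
have mFl : vmeas (F \o l) by exact: vmeas_hom.
have Fl0 x : (0 <= (F \o l) x)%E by exact: F0.
have FN : iint (onb W) F 0%R = 0%E.
  by rewrite -integral_hilbert// integral_indic// setIT.
have mpre : measurable ((l : borel V -> borel W) @^-1` N).
  by rewrite -[_ @^-1` _]setTI; exact: measurable_hom.
rewrite -[LHS]/(hilbert_lebesgue V _) -[X in hilbert_lebesgue V X]setIT -integral_indic//.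
rewrite -[LHS]/(\int[hilbert_lebesgue V]_x (F \o l) x)%E integral_hilbert//.
pose K := lker l; pose U := (fullv :\: K)%VS.
have UK : (U + K = fullv)%VS by rewrite addv_diff; apply/addv_idPl; exact: subvf.
have basl : basis_of fullv (map l (vbasis U)).
  rewrite -(surj_limg surj) -UK limgD [X in (_ + X)%VS](_ : _ = 0%VS) ?addv0.
    by apply: limg_basis_of; [exact: capv_diff|exact: vbasisP].
  by apply/eqP; rewrite -lkerE.
have basV : basis_of fullv (vbasis K ++ vbasis U).
  apply/andP; split.
    by rewrite span_cat !(span_basis (vbasisP _)) addvC UK.
  rewrite /free span_cat !(span_basis (vbasisP _)) addvC UK size_cat !size_tuple.
  by rewrite -(dimv_cap_compl fullv K) (capv_idPr (subvf _)).
have [C [C0 HC]] := iint_basis (onb_basis V) basV.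
have [C' [C'0 HC']] := iint_basis basl (onb_basis W).
apply/le_anti; rewrite iint_ge0 ?andbT//.
apply: (le_trans (HC _ _ mFl Fl0)).
rewrite iint_cat (@eq_iint _ _ _ _ (fun=> 0%E)) ?iint_cst0 ?mule0// => x.
rewrite (iint_hom l) -[l x]add0r iint_invariant//; last first.
  by case/andP: basl => /eqP -> _; rewrite memvf.
apply/le_anti; rewrite iint_ge0 ?andbT//.
by apply: (le_trans (HC' _ _ mF F0)); rewrite FN mule0.
Qed.

(** Essential bounds on the targets hold only almost everywhere; this pulls them back to the
    source. *)
Lemma ae_preimage (P : set W) : almost_everywhere (hilbert_lebesgue W) (P : set (borel W)) ->
  almost_everywhere (hilbert_lebesgue V) (fun x : borel V => P (l x)).
Proof.
move=> [N [mN N0 PN]]; exists ((l : borel V -> borel W) @^-1` N); split.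
- by rewrite -[_ @^-1` _]setTI; exact: measurable_hom.
- exact: hilbert_null_preimage.
- by move=> x /= Px; apply: PN.
Qed.

End null_preimage.

Section single_source.
Variables (R : realType) (V : hilbert R) (J : finType) (W : J -> hilbert R).
Variables (l : forall j, 'Hom(V, W j)) (p : J -> \bar R).
Hypothesis surj : forall j (y : W j), exists x, l j x = y.
Hypothesis p_ge1 : forall j, (1 <= p j)%E.

Lemma BL_single_source :
  feasible (H := fun j => hvect (W j)) fullv l (fun j => fine (p j)^-1%E) ->
  exists C : R, 0 < C /\ forall f : (forall j, borel (W j) -> \bar R),
    (forall j, measurable_fun setT (f j)) -> (forall j y, (0 <= f j y)%E) ->
    (\int[hilbert_lebesgue V]_x \prod_j f j (l j x) <=
     C%:E * \prod_j 'N[hilbert_lebesgue (W j)]_(p j)[f j])%E.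
Proof.
move=> /feasible_BL_finite[C [C0 HC]].
have [C1 [C10 HC1]] := iint_basis (onb_basis V) (vbasisP fullv).
have /choice[C2 HC2] j : exists C : R, 0 < C /\ forall F x, vmeas F -> (forall y, 0 <= F y)%E ->
    (iint (vbasis (l j @: fullv)%VS) F x <= C%:E * iint (onb (W j)) F x)%E.
  by apply: iint_basis (onb_basis _); rewrite (surj_limg (@surj j)); exact: vbasisP.
pose th j := fine (p j)^-1%E.
have th0 j : 0 <= th j.
  by rewrite fine_ge0// inve_ge0 (le_trans _ (p_ge1 j)).
exists (C1 * (C * \prod_j C2 j `^ th j)); split.
  by rewrite !mulr_gt0// prodr_gt0// => j _; rewrite powR_gt0//; case: (HC2 j).
move=> f mf f0.
pose nrm j := 'N[hilbert_lebesgue (W j)]_(p j)[f j]%E.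
(* Factors with infinite exponent are replaced by their norm [K j]; in the others, [g j] is the
   power whose integral the norm measures. *)
pose K j := (if p j == +oo then nrm j else 1)%E.
pose g j (y : W j) : \bar R := (if p j == +oo then 1 else f j y `^ fine (p j))%E.
have K0 j : (0 <= K j)%E by rewrite /K; case: ifP => // _; exact: Lnorm_ge0.
have g0 j y : (0 <= g j y)%E by rewrite /g; case: ifP => // _; exact: poweR_ge0.
have mg j : vmeas (g j).
  rewrite /g; case: (p j == +oo%E); first exact: vmeas_cst.
  by apply: vmeas_poweR; apply/vmeas_borelP.
have normE j : (K j * (\int[hilbert_lebesgue (W j)]_y g j y) `^ th j = nrm j)%E.
  rewrite /K /g /th /nrm; have := p_ge1 j; case: (p j) => [q| |]//=.
    rewrite lee_fin => q1; have q0 : q != 0 by rewrite gt_eqF// (lt_le_trans _ q1).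
    rewrite mul1e inver (negPf q0) /= unlock /Lnorm.
    by congr (_ `^ _)%E; apply: eq_integral => y _; rewrite gee0_abs.
  by move=> _; rewrite poweRe0 mule1.
have point : almost_everywhere (hilbert_lebesgue V) (fun x : borel V =>
    (\prod_j f j (l j x) <= \prod_j (K j * g j (l j x) `^ th j))%E).
  have : almost_everywhere (hilbert_lebesgue V) (fun x : borel V => forall j,
      (f j (l j x) <= K j * g j (l j x) `^ th j)%E).
    pose bound j (y : W j) := (f j y <= K j * g j y `^ th j)%E.
    apply: (@filter_forall _ J (fun j (x : borel V) => bound j (l j x)) _
      (ae_filter_ringOfSetsType _)) => j.
    apply: (@ae_preimage _ _ _ (l j) (@surj j) (bound j)); rewrite /bound.
    rewrite /K /g /th /nrm; have [py|py] := eqVneq (p j) +oo%E.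
      have := ess_sup_ge (hilbert_lebesgue (W j)) (abse \o f j).
      rewrite py unlock (hilbert_lebesgue_gt0 (W j)) invey.
      by apply: filterS => y; rewrite /comp gee0_abs// poweRe0 mule1.
    have [q pq] : exists q, p j = q%:E.
      by exists (fine (p j)); rewrite fineK// ge0_fin_numE ?ltey// (le_trans _ (p_ge1 j)).
    have q0 : q != 0 by rewrite gt_eqF// (lt_le_trans ltr01)// -lee_fin -pq.
    apply: (@filterE _ (almost_everywhere (hilbert_lebesgue (W j)))) => y.
    rewrite pq inver (negPf q0) /= mul1e.
    by rewrite -poweRrM mulfV// poweRe1.
  by move=> fK; apply: filterS fK => x fK; apply: lee_prod.
have gth0 j y : (0 <= K j * g j y `^ th j)%E by rewrite mule_ge0// poweR_ge0.
have mG : vmeas (fun x => \prod_j g j (l j x) `^ th j)%E.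
  exact: vmeas_prod_poweR.
have G0 x : (0 <= \prod_j g j (l j x) `^ th j)%E by apply: prode_ge0 => j _; exact: poweR_ge0.
have KK0 : (0 <= \prod_j K j)%E by exact: prode_ge0.
apply: (@le_trans _ _ (\int[hilbert_lebesgue V]_x ((\prod_j K j) * \prod_j g j (l j x) `^ th j))%E).
  apply: ae_ge0_le_integral => //.
  - by move=> x _; apply: prode_ge0.
  - apply/vmeas_borelP; apply: vmeas_prod => j.
    by apply: (@vmeas_hom _ _ _ (l j) (f j)); apply/vmeas_borelP.
  - by move=> x _; exact: mule_ge0.
  - by apply/vmeas_borelP; apply: vmeasM => //; exact: vmeas_cst.
  - by apply: filterS point => x + _; rewrite big_split.
rewrite ge0_integralZl//; last exact/vmeas_borelP.
rewrite integral_hilbert//.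
under [X in (_ <= _ * X)%E]eq_bigr do rewrite -/(nrm _) -normE.
rewrite big_split /= muleCA; apply: lee_wpmul2l => //.
apply: (le_trans (HC1 _ _ mG G0)); rewrite EFinM -muleA.
apply: lee_wpmul2l; first by rewrite lee_fin ltW.
apply: (le_trans (HC g mg g0)); rewrite EFinM -muleA.
apply: lee_wpmul2l; first by rewrite lee_fin ltW.
rewrite -prodEFin -big_split /=; apply: lee_prod => j; first exact: poweR_ge0.
have [C2j0 HC2j] := HC2 j.
rewrite (integral_hilbert (mg j) (g0 j)).
rewrite -poweR_EFin -poweRM ?lee_fin ?(ltW C2j0) ?iint_ge0//.
apply: gt0_ler_poweR; rewrite ?th0//= ?in_itv/= ?leey ?andbT//.
- by rewrite iint_ge0.
- by rewrite mule_ge0 ?iint_ge0// lee_fin ltW.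
- exact: HC2j.
Qed.

End single_source.

(** * Dilations *)

Section dilation.
Variables (R : realType) (E : vectType R).
Implicit Types (U : {vspace E}) (x y : R).

(** With exponential factors, negating [x] and [y] gives the inverse, and the Jacobian is the
    exponential of a linear form in [x] and [y]. *)
Definition dilation U x y : 'End(E) :=
  expR x *: projv U + expR y *: (\1%VF - projv U).

Lemma dilationE U x y z :
  dilation U x y z = expR x *: projv U z + expR y *: (z - projv U z).
Proof. by rewrite /dilation !lfun_simp. Qed.

Lemma projv_idem U z : projv U (projv U z) = projv U z.
Proof. by rewrite projv_id// memv_proj. Qed.

Lemma projv_dilation U x y z : projv U (dilation U x y z) = expR x *: projv U z.
Proof.
by rewrite dilationE linearD !linearZ /= linearB /= !projv_idem subrr scaler0 addr0.
Qed.

Lemma projvC_dilation U x y z :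
  dilation U x y z - projv U (dilation U x y z) = expR y *: (z - projv U z).
Proof. by rewrite projv_dilation dilationE addrC addKr. Qed.

Lemma dilationK U x y z : dilation U x y (dilation U (- x) (- y) z) = z.
Proof.
rewrite dilationE projvC_dilation projv_dilation !scalerA -!expRD !subrr expR0.
by rewrite !scale1r addrC subrK.
Qed.

Lemma projv_compl U z : z \in (U^C)%VS -> projv U z = 0.
Proof.
move=> zU; have e1 : daddv_pi U^C U z = z.
  by apply: daddv_pi_id => //; rewrite capvC capv_compl.
have zT : z \in (U + U^C)%VS by rewrite addv_complf memvf.
have := daddv_pi_add (capv_compl U) zT.
by rewrite e1 => /(canRL (addrK z)); rewrite subrr.
Qed.

Lemma iint_scale (b : seq E) (F : E -> \bar R) (z : E) (c : R) : 0 < c ->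
  vmeas F -> (forall u, 0 <= F u)%E ->
  iint [seq c *: v | v <- b] F z = ((c^-1 ^+ size b)%:E * iint b F z)%E.
Proof.
move=> c0 mF F0; elim: b z => [|v b IH] z /=; first by rewrite expr0 mul1e.
transitivity (\int[@lebesgue_measure R]_s ((c^-1 ^+ size b)%:E * iint b F (z + (s * c) *: v)))%E.
  by apply: eq_integral => s _; rewrite IH scalerA.
rewrite (@lebesgue_integral_scale _ (fun s => (c^-1 ^+ size b)%:E * iint b F (z + s *: v))%E c) ?gt_eqF//.
- rewrite ge0_integralZl//; last 3 first.
  + exact: measurable_iint_line.
  + by move=> s _; exact: iint_ge0.
  + by rewrite lee_fin exprn_ge0// invr_ge0 ltW.
  by rewrite muleA -EFinM exprS gtr0_norm.
- by apply: measurable_funeM; exact: measurable_iint_line.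
- by move=> s; rewrite mule_ge0 ?iint_ge0// lee_fin exprn_ge0// invr_ge0 ltW.
Qed.

Lemma iint_dilation U x y (F : E -> \bar R) :
  vmeas F -> (forall z, 0 <= F z)%E ->
  iint (vbasis U ++ vbasis U^C) (fun z => F (dilation U (- x) (- y) z)) 0 =
  ((expR (x * (\dim U)%:R + y * (\dim U^C)%:R))%:E *
   iint (vbasis U ++ vbasis U^C) F 0)%E.
Proof.
move=> mF F0; rewrite iint_hom linear0 map_cat !iint_cat.
have -> : map (dilation U (- x) (- y)) (vbasis U) = [seq expR (- x) *: v | v <- vbasis U].
  apply/eq_in_map => v /(memv_span) ; rewrite (span_basis (vbasisP _)) => vU.
  by rewrite dilationE projv_id// subrr scaler0 addr0.
have -> : map (dilation U (- x) (- y)) (vbasis U^C) = [seq expR (- y) *: v | v <- vbasis U^C].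
  apply/eq_in_map => v /(memv_span) ; rewrite (span_basis (vbasisP _)) => vU.
  by rewrite dilationE projv_compl// subr0 scaler0 add0r.
rewrite iint_scale ?expR_gt0//; last 2 first.
- exact: vmeas_iint.
- by move=> z; exact: iint_ge0.
under eq_iint do rewrite iint_scale ?expR_gt0//.
rewrite iintZ; [|exact: vmeas_iint|by move=> z; exact: iint_ge0|
  by rewrite lee_fin exprn_ge0// invr_ge0 expR_ge0].
by rewrite !size_tuple -!expRN !opprK muleA -EFinM -!expRM_natr -expRD.
Qed.

End dilation.

Section cube_dilation.
Variable R : realType.

Lemma cube_linear_bound (V W : hilbert R) (T : 'Hom(V, W)) :
  exists2 K : R, 0 <= K & forall z, @cube R V 1 z -> @cube R W K (T z).
Proof.
pose K := \sum_k \sum_i `|coord (onb W) k (T (tnth (onb V) i))|.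
exists K; first by apply: sumr_ge0 => k _; apply: sumr_ge0.
move=> z zc k; rewrite [z in T z]onb_coordE linear_sum linear_sum /=.
apply: (le_trans (ler_norm_sum _ _ _)).
apply: (@le_trans _ _ (\sum_i `|coord (onb W) k (T (tnth (onb V) i))|)).
  by apply: ler_sum => i _; rewrite linearZ linearZ /= normrM ler_piMl.
rewrite /K [leRHS](bigD1 k)//= lerDl; apply: sumr_ge0 => j _; exact: sumr_ge0.
Qed.

Lemma cubeD (V : hilbert R) a b (y z : V) :
  @cube R V a y -> @cube R V b z -> @cube R V (a + b) (y + z).
Proof.
move=> ya zb k; rewrite linearD; apply: (le_trans (ler_normD _ _)).
by rewrite lerD// ?ya ?zb.
Qed.

(** [B] is block triangular for the two splittings, as it maps [U] into [B @: U]. Conjugation fixes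
    the diagonal blocks and multiplies the remaining one, from the complement into [B @: U], by
    [expR (y - x)], at most 1. *)
Lemma dilation_conj_bound (V W : hilbert R) (B : 'Hom(V, W)) (U : {vspace V}) :
  exists2 M : R, 0 < M & forall x y z, y <= x -> @cube R V 1 z ->
    @cube R W M (dilation (B @: U)%VS (- x) (- y) (B (dilation U x y z))).
Proof.
set U' := (B @: U)%VS.
have [K1 K10 H1] := cube_linear_bound (B \o projv U)%VF.
have [K2 K20 H2] := cube_linear_bound (projv U' \o (B \o (\1%VF - projv U)%R))%VF.
have [K3 K30 H3] := cube_linear_bound ((\1%VF - projv U')%R \o (B \o (\1%VF - projv U)%R))%VF.
exists (K1 + K2 + K3 + 1); first by rewrite ltr_wpDl// !addr_ge0.
move=> x y z yx zc.
have e : dilation U' (- x) (- y) (B (dilation U x y z)) =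
    (B \o projv U)%VF z + expR (y - x) *: (projv U' \o (B \o (\1%VF - projv U)%R))%VF z +
    ((\1%VF - projv U')%R \o (B \o (\1%VF - projv U)%R))%VF z.
  have -> : (B \o projv U)%VF z = B (projv U z) by rewrite !lfun_simp.
  have -> : (projv U' \o (B \o (\1%VF - projv U)%R))%VF z = projv U' (B (z - projv U z)).
    by rewrite !lfun_simp.
  have -> : ((\1%VF - projv U')%R \o (B \o (\1%VF - projv U)%R))%VF z =
      B (z - projv U z) - projv U' (B (z - projv U z)).
    by rewrite !lfun_simp.
  rewrite dilationE.
  have -> : B (dilation U x y z) = expR x *: B (projv U z) + expR y *: B (z - projv U z).
    by rewrite dilationE linearD !linearZ.
  have aU : B (projv U z) \in U' by rewrite memv_img// memv_proj.
  set a := B (projv U z) in aU *; set w := B (z - projv U z).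
  have -> : projv U' (expR x *: a + expR y *: w) = expR x *: a + expR y *: projv U' w.
    by rewrite linearD !linearZ /= (projv_id aU).
  rewrite opprD addrACA subrr add0r -scalerBr scalerDr !scalerA -!expRD.
  by rewrite !addNr expR0 !scale1r [y - x]addrC.
rewrite e => k; apply: (@le_trans _ _ (K1 + K2 + K3)); last by rewrite lerDl.
apply: cubeD; last exact: H3.
apply: cubeD; first exact: H1.
move=> i; rewrite linearZ normrM ger0_norm ?expR_ge0//.
apply: (@le_trans _ _ (1 * K2)); last by rewrite mul1r.
apply: ler_pM => //.
  by rewrite -expR0 ler_expR subr_le0.
exact: H2.
Qed.

(** Passing from [onb V] to a basis adapted to [U] and back costs a constant [K] that does not
    depend on [x] and [y]. *)
Lemma integral_dilation_bounds (V : hilbert R) (U : {vspace V}) :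
  exists2 K : R, 0 < K & forall x y (F : V -> \bar R), vmeas F -> (forall z, 0 <= F z)%E ->
    let e := expR (x * (\dim U)%:R + y * (\dim U^C)%:R) in
    (\int[hilbert_lebesgue V]_z F (dilation U (- x) (- y) z) <=
      (K * e)%:E * \int[hilbert_lebesgue V]_z F z)%E /\
    (e%:E * \int[hilbert_lebesgue V]_z F z <=
      K%:E * \int[hilbert_lebesgue V]_z F (dilation U (- x) (- y) z))%E.
Proof.
have bas : basis_of fullv (vbasis U ++ vbasis U^C).
  apply/andP; split; first by rewrite span_cat !(span_basis (vbasisP _)) addv_complf.
  rewrite /free span_cat !(span_basis (vbasisP _)) addv_complf size_cat !size_tuple.
  by rewrite dimv_compl subnKC// dimvS// subvf.
have [C [C0 HC]] := iint_basis (onb_basis V) bas.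
have [C' [C'0 HC']] := iint_basis bas (onb_basis V).
exists (C * C'); first exact: mulr_gt0.
move=> x y F mF F0 e; have e0 : 0 <= e by exact: expR_ge0.
have mFD : vmeas (fun z => F (dilation U (- x) (- y) z)) by exact: vmeas_hom.
rewrite !integral_hilbert//; split.
  apply: (le_trans (HC _ _ mFD _)) => //; rewrite iint_dilation// -/e.
  apply: (@le_trans _ _ (C%:E * (e%:E * (C'%:E * iint (onb V) F 0)))%E).
    by rewrite !lee_wpmul2l ?lee_fin ?(ltW C0)//; exact: HC'.
  rewrite !muleA -!EFinM; suff -> : C * e * C' = C * C' * e by [].
  by ring.
apply: (@le_trans _ _ (e%:E * (C%:E * iint (vbasis U ++ vbasis U^C) F 0))%E).
  by rewrite lee_wpmul2l ?lee_fin//; exact: HC.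
rewrite muleCA -iint_dilation// EFinM -muleA lee_wpmul2l ?lee_fin ?(ltW C0)//.
exact: HC'.
Qed.

End cube_dilation.

(** * The theorem *)

Lemma expR_asymptotic_le (R : realType) (k c a b : R) : 0 < k ->
  (forall t, 0 <= t -> k * expR (t * a) <= c * expR (t * b)) -> a <= b.
Proof.
move=> k0 H; rewrite leNgt -subr_gt0; apply/negP => ab.
have {}H t : 0 <= t -> k * expR (t * (a - b)) <= c.
  by move=> /H; rewrite mulrBr expRD expRN mulrA ler_pdivrMr ?expR_gt0.
have c0 : 0 < c by apply: lt_le_trans (H 0 (lexx 0)); rewrite mul0r expR0 mulr1.
(* At this [t] the bound [1 + s <= expR s] makes the left side at least [k + c]. *)
have := H (c / k / (a - b)); rewrite divfK ?gt_eqF//.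
rewrite !divr_ge0 ?(ltW c0) ?(ltW k0) ?(ltW ab)// => /(_ isT).
rewrite leNgt => /negP; apply; apply: (@lt_le_trans _ _ (k * (1 + c / k))).
  by rewrite mulrDr mulr1 [k * (c / k)]mulrC divfK ?gt_eqF// ltrDr.
by rewrite ler_wpM2l ?(ltW k0)// expR_ge1Dx.
Qed.

(** The exponent 0 attached to [+oo] turns the bound into 1, so one formula serves all [p]. *)
Lemma Lnorm_indicator_le (R : realType) (W : hilbert R) (A : set (borel W))
    (p : \bar R) (c : R) : (1 <= p)%E -> measurable A ->
  (hilbert_lebesgue W A <= c%:E)%E ->
  ('N[hilbert_lebesgue W]_p[(fun y => (\1_A y)%:E)] <= (c `^ fine p^-1%E)%:E)%E.
Proof.
move=> p1 mA Ac.
have [py|py] := eqVneq p +oo%E.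
  rewrite py unlock hilbert_lebesgue_gt0 invey powRr0.
  apply/ess_supP; apply: (@filterE _ (almost_everywhere (hilbert_lebesgue W))) => y.
  by rewrite /comp gee0_abs ?lee_fin// indicE; case: (_ \in _).
have [q pq] : exists q, p = q%:E.
  by exists (fine p); rewrite fineK// ge0_fin_numE ?ltey// (le_trans _ p1).
have q0 : 0 < q by rewrite (lt_le_trans ltr01)// -lee_fin -pq.
rewrite pq inver gt_eqF// -poweR_EFin unlock.
rewrite (@eq_integral _ _ _ _ _ (fun y => (\1_A y)%:E)); last first.
  move=> y _; rewrite gee0_abs ?lee_fin// poweR_EFin indicE.
  by case: (_ \in _); rewrite ?powR1// powR0// gt_eqF.
rewrite integral_indic// setIT.
have A0 : (0 <= hilbert_lebesgue W A)%E by exact: measure_ge0.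
by apply: gt0_ler_poweR; rewrite ?invr_ge0 ?(ltW q0)// in_itv /= leey andbT// (le_trans A0).
Qed.

Section theorem.
Variables (R : realType) (n m : nat) (Q : bipartite_rep R n m) (p : 'I_m -> \bar R).
Hypothesis p_ge1 : forall j, (1 <= p j)%E.
Local Notation th j := (fine (p j)^-1%E).

Lemma exponentE j : (p j)^-1%E = (th j)%:E.
Proof.
rewrite fineK// ge0_fin_numE ?inve_ge0 ?(le_trans _ (p_ge1 j))//.
by rewrite ltey inve_eqy; apply: contraTneq (p_ge1 j) => ->; rewrite -ltNge.
Qed.

Lemma exponent_itv j : 0 <= th j <= 1.
Proof.
rewrite -!lee_fin -exponentE inve_ge0 (le_trans _ (p_ge1 j))//=.
have := p_ge1 j; case: (p j) => [q| |]//.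
  rewrite lee_fin => q1; have q0 : 0 < q by exact: lt_le_trans q1.
  by rewrite inver gt_eqF// lee_fin invf_le1.
by rewrite invey.
Qed.

(** * Necessity: testing on dilated cubes *)

Section necessity.
Variable V : forall i, {vspace source Q i}.
Let A1 : R := \sum_i (\dim (V i))%:R.
Let A2 : R := \sum_i (\dim (V i)^C)%:R.
Let B1 : R := \sum_i \sum_j \sum_(a : arrow Q i j) th j * (\dim (arrow_map Q a @: V i)%VS)%:R.
Let B2 : R := \sum_i \sum_j \sum_(a : arrow Q i j) th j * (\dim (arrow_map Q a @: V i)^C%VS)%:R.

(** Each [f] is the indicator of a dilated cube large enough that every factor equals 1 on the
    dilated unit cube of its source. Volumes then bound the left side below and norms bound the
    right side above. *)
Lemma BL_dilation_test (C : R) : 0 < C -> BL_inequality Q p C%:E ->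
  exists k c : R, 0 < k /\ forall x y, y <= x ->
    k * expR (x * A1 + y * A2) <= c * expR (x * B1 + y * B2).
Proof.
move=> C0 BL.
(* All constants are extracted before [x] and [y] are introduced, so [k] and [c] do not depend on
   the dilation. *)
pose sM i j (a : arrow Q i j) := cid2 (dilation_conj_bound (arrow_map Q a) (V i)).
pose M i j (a : arrow Q i j) := s2val (sM i j a).
have M0 i j (a : arrow Q i j) : 0 < M i j a := s2valP (sM i j a).
have MP i j (a : arrow Q i j) := s2valP' (sM i j a).
pose sT i j (a : arrow Q i j) := cid2 (integral_dilation_bounds (arrow_map Q a @: V i)%VS).
pose Kt i j (a : arrow Q i j) := s2val (sT i j a).
have Kt0 i j (a : arrow Q i j) : 0 < Kt i j a := s2valP (sT i j a).
have KtP i j (a : arrow Q i j) := s2valP' (sT i j a).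
pose sS i := cid2 (integral_dilation_bounds (V i)).
pose Ks i := s2val (sS i).
have Ks0 i : 0 < Ks i := s2valP (sS i).
have KsP i := s2valP' (sS i).
pose ks i := (2 ^+ \dim {: source Q i}) / Ks i : R.
pose ct i j (a : arrow Q i j) :=
  (Kt i j a * (2 * M i j a) ^+ \dim {: target Q j}) `^ th j.
exists (\prod_i ks i), (C * \prod_i \prod_j \prod_(a : arrow Q i j) ct i j a); split.
  by apply: prodr_gt0 => i _; rewrite divr_gt0// exprn_gt0.
move=> x y yx.
pose S i j (a : arrow Q i j) : set (borel (target Q j)) :=
  dilation (arrow_map Q a @: V i)%VS (- x) (- y) @^-1` @cube R (target Q j) (M i j a).
have mdil (W : hilbert R) U r : measurable
    ((dilation U (- x) (- y) : borel W -> borel W) @^-1` @cube R W r).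
  by rewrite -[_ @^-1` _]setTI; apply: measurable_hom => //; exact: measurable_cube.
have vcube (W : hilbert R) r : vmeas (fun z : W => (\1_(@cube R W r) z)%:E).
  by apply/vmeas_borelP; apply/measurable_EFinP; apply: measurable_indic; exact: measurable_cube.
have cube0 (W : hilbert R) r (z : W) : (0 <= (\1_(@cube R W r) z)%:E :> \bar R)%E.
  by rewrite lee_fin.
have integral_cube (W : hilbert R) r : 0 <= r ->
    (\int[hilbert_lebesgue W]_z (\1_(@cube R W r) z)%:E = ((2 * r) ^+ \dim {:W})%:E)%E.
  move=> r0; rewrite integral_indic ?setIT; [|by []|exact: measurable_cube].
  exact: hilbert_lebesgue_cube.
have mS i j a : measurable (S i j a) by exact: mdil.
pose f i j (a : arrow Q i j) (z : borel (target Q j)) : \bar R := (\1_(S i j a) z)%:E.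
have := BL f.
have mf i j a : measurable_fun [set: borel (target Q j)] (f i j a).
  by apply/measurable_EFinP; exact: measurable_indic.
have f0 i j a z : (0 <= f i j a z)%E by rewrite lee_fin.
move=> /(_ mf f0) main.
have upper i j (a : arrow Q i j) : ('N[hilbert_lebesgue (target Q j)]_(p j)[f i j a] <=
    (ct i j a * expR (th j * (x * (\dim (arrow_map Q a @: V i)%VS)%:R +
       y * (\dim (arrow_map Q a @: V i)^C%VS)%:R)))%:E)%E.
  set u := (x * _ + y * _).
  pose c := Kt i j a * (2 * M i j a) ^+ \dim {: target Q j} * expR u.
  have Sc : (hilbert_lebesgue (target Q j) (S i j a) <= c%:E)%E.
    have [h _] := KtP i j a x y _ (vcube _ (M i j a)) (cube0 _ _).
    have -> : hilbert_lebesgue (target Q j) (S i j a) =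
        (\int[hilbert_lebesgue (target Q j)]_z (\1_(S i j a) z)%:E)%E.
      by rewrite integral_indic// setIT.
    apply: (le_trans h); rewrite integral_cube ?(ltW (M0 _ _ _))// -EFinM lee_fin.
    by rewrite /c -/u mulrAC.
  apply: (le_trans (Lnorm_indicator_le (p_ge1 j) (mS i j a) Sc)).
  rewrite lee_fin /c powRM ?expR_ge0 ?mulr_ge0 ?(ltW (Kt0 _ _ _)) ?exprn_ge0 ?mulr_ge0 ?(ltW (M0 _ _ _))//.
  by rewrite -expRM [u * _]mulrC.
have lower i : ((ks i * expR (x * (\dim (V i))%:R + y * (\dim (V i)^C%VS)%:R))%:E <=
    \int[hilbert_lebesgue (source Q i)]_z
        \prod_(j < m) \prod_(a : arrow Q i j) f i j a (arrow_map Q a z))%E.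
  set e := expR _; have [_ h] := KsP i x y _ (vcube _ 1) (cube0 _ _).
  apply: (@le_trans _ _ (\int[hilbert_lebesgue (source Q i)]_z
      (\1_(@cube R (source Q i) 1) (dilation (V i) (- x) (- y) z))%:E)%E).
    rewrite /ks mulrAC mulrC EFinM lee_pdivrMl//; apply: le_trans h.
    by rewrite integral_cube// mulr1 -EFinM lee_fin mulrC.
  apply: ge0_le_integral => //.
  - apply/vmeas_borelP.
    exact: (@vmeas_hom _ _ _ (dilation (V i) (- x) (- y))
      (fun z => (\1_(@cube R (source Q i) 1) z)%:E)).
  - apply/vmeas_borelP; do 2![apply: vmeas_prod => ?].
    by apply: (@vmeas_hom _ _ _ _ (f _ _ _)); apply/vmeas_borelP.
  - move=> z _; rewrite indicE; have [zc|zc] := boolP (_ \in _); last first.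
      by do 2![apply: prode_ge0 => ? _].
    rewrite big1 ?lexx// => j _; rewrite big1// => a _.
    rewrite /f indicE mem_set// /S /=.
    (* The undilated point lies in the unit cube, so its dilation is sent by the arrow into
       [S i j a]; this uses [y <= x]. *)
    have := MP i j a x y (dilation (V i) (- x) (- y) z) yx.
    by rewrite dilationK; apply; move/set_mem: zc.
have : (\prod_i (ks i * expR (x * (\dim (V i))%:R + y * (\dim (V i)^C%VS)%:R))%:E <=
    C%:E * \prod_i \prod_j \prod_(a : arrow Q i j)
    (ct i j a * expR (th j * (x * (\dim (arrow_map Q a @: V i)%VS)%:R +
       y * (\dim (arrow_map Q a @: V i)^C%VS)%:R)))%:E)%E.
  apply: (le_trans (lee_prod _ _ lower)).
    by move=> i; rewrite lee_fin mulr_ge0 ?expR_ge0// divr_ge0// ?exprn_ge0// ltW.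
  apply: (le_trans main); apply: lee_wpmul2l; first by rewrite lee_fin ltW.
  apply: lee_prod => i; first by do 2![apply: prode_ge0 => ? _]; exact: Lnorm_ge0.
  apply: lee_prod => j; first by apply: prode_ge0 => ? _; exact: Lnorm_ge0.
  by apply: lee_prod => a; [exact: Lnorm_ge0|exact: upper].
set w := fun i j (a : arrow Q i j) => th j * (x * (\dim (arrow_map Q a @: V i)%VS)%:R +
       y * (\dim (arrow_map Q a @: V i)^C%VS)%:R).
have -> : (\prod_i \prod_j \prod_(a : arrow Q i j) (ct i j a * expR (w i j a))%:E =
    ((\prod_i \prod_j \prod_(a : arrow Q i j) ct i j a) *
     expR (\sum_i \sum_j \sum_(a : arrow Q i j) w i j a))%:E)%E.
  rewrite expR_sum -big_split -prodEFin /=; apply: eq_bigr => i _.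
  rewrite expR_sum -big_split -prodEFin /=; apply: eq_bigr => j _.
  by rewrite expR_sum -big_split -prodEFin.
rewrite prodEFin -EFinM lee_fin.
rewrite big_split /= -expR_sum mulrA.
congr (_ * expR _ <= _ * expR _).
  by rewrite big_split /= -!mulr_sumr.
rewrite /B1 /B2 !mulr_sumr -big_split /=; apply: eq_bigr => i _.
rewrite !mulr_sumr -big_split /=; apply: eq_bigr => j _.
rewrite !mulr_sumr -big_split /=; apply: eq_bigr => a _.
by rewrite /w mulrDr !(mulrCA (th j)).
Qed.

Lemma BL_necessary_at : (BL_constant Q p < +oo)%E ->
  \sum_i (\dim {: source Q i})%:R = \sum_i \sum_j \sum_(a : arrow Q i j)
    th j * (\dim {: target Q j})%:R /\ A1 <= B1.
Proof.
move=> /ereal_inf_lt[C' [C'0 BL'] C'y].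
(* An admissible finite constant may be zero; adding 1 makes it positive. *)
have [C [C0 BL]] : exists C : R, 0 < C /\ BL_inequality Q p C%:E.
  exists (fine C' + 1); split; first by rewrite ltr_wpDl// fine_ge0.
  move=> f mf f0; apply: (le_trans (BL' f mf f0)); apply: lee_wpmul2r.
    by do 3![apply: prode_ge0 => ? _]; exact: Lnorm_ge0.
  by rewrite EFinD fineK ?ge0_fin_numE// leeDl.
have [k [c [k0 H]]] := BL_dilation_test C0 BL.
have compl (W : vectType R) (U : {vspace W}) :
    (\dim U)%:R + (\dim U^C)%:R = (\dim {:W})%:R :> R.
  by rewrite -natrD dimv_compl subnKC// dimvS// subvf.
set A := LHS; set B := RHS.
have AE : A1 + A2 = A by rewrite -big_split; apply: eq_bigr => i _; exact: compl.
have BE : B1 + B2 = B.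
  rewrite -big_split; apply: eq_bigr => i _; rewrite -big_split; apply: eq_bigr => j _.
  by rewrite -big_split; apply: eq_bigr => a _; rewrite /= -mulrDr compl.
(* The three choices are [x = y = t], then [x = y = - t], then [x = 0] and [y = - t]; the last
   concerns only the complements. *)
have AB : A <= B.
  apply: (expR_asymptotic_le k0 (c := c)) => t t0.
  by rewrite -AE -BE !mulrDr; exact: H.
have BA : - A <= - B.
  apply: (expR_asymptotic_le k0 (c := c)) => t t0.
  by rewrite !mulrN -!mulNr -AE -BE !mulrDr; exact: H.
have BA2 : - A2 <= - B2.
  apply: (expR_asymptotic_le k0 (c := c)) => t t0.
  rewrite !mulrN -!mulNr; have := H 0 (- t); rewrite !mul0r !add0r; apply.
  by rewrite oppr_le0.
split; first by apply/le_anti; rewrite AB -lerN2.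
have -> : A1 = A - A2 by rewrite -AE addrK.
have -> : B1 = B - B2 by rewrite -BE addrK.
exact: lerD.
Qed.

End necessity.

Lemma BL_necessary : (BL_constant Q p < +oo)%E ->
  \sum_i (\dim {: source Q i})%:R = \sum_i \sum_j \sum_(a : arrow Q i j)
    th j * (\dim {: target Q j})%:R /\
  forall V : (forall i, {vspace source Q i}),
    \sum_i (\dim (V i))%:R <= \sum_i \sum_j \sum_(a : arrow Q i j)
      th j * (\dim (arrow_map Q a @: V i)%VS)%:R :> R.
Proof.
move=> fin; split; last by move=> V; have [] := BL_necessary_at V fin.
(* The scaling identity does not involve the subspaces, so any family will do. *)
by have [] := BL_necessary_at (fun=> fullv) fin.
Qed.

Lemma BL_sufficient :
  \sum_i (\dim {: source Q i})%:R = \sum_i \sum_j \sum_(a : arrow Q i j)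
    th j * (\dim {: target Q j})%:R ->
  (forall V : (forall i, {vspace source Q i}),
    \sum_i (\dim (V i))%:R <= \sum_i \sum_j \sum_(a : arrow Q i j)
      th j * (\dim (arrow_map Q a @: V i)%VS)%:R :> R) ->
  (BL_constant Q p < +oo)%E.
Proof.
move=> scal sub.
have surj i j (a : arrow Q i j) : (arrow_map Q a @: fullv)%VS = fullv.
  exact: surj_limg (arrow_map_surj a).
(* Filling the other sources with the zero subspace decouples the condition. *)
have sub1 i (U : {vspace source Q i}) :
    (\dim U)%:R <= \sum_j \sum_(a : arrow Q i j) th j * (\dim (arrow_map Q a @: U)%VS)%:R :> R.
  have := sub (@dfwith _ (fun i => {vspace source Q i}) (fun=> 0%VS) i U).
  rewrite (bigD1 i)//= [X in _ <= X](bigD1 i)//= dfwithin.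
  rewrite big1 ?addr0; last by move=> k ki; rewrite dfwithout 1?eq_sym// dimv0.
  rewrite [X in _ <= _ + X]big1 ?addr0//.
  move=> k ki; rewrite big1// => j _; rewrite big1// => a _.
  by rewrite dfwithout 1?eq_sym// limg0 dimv0 mulr0.
have scal1 i : (\dim {: source Q i})%:R =
    \sum_j \sum_(a : arrow Q i j) th j * (\dim {: target Q j})%:R :> R.
  have le1 k : (\dim {: source Q k})%:R <=
      \sum_j \sum_(a : arrow Q k j) th j * (\dim {: target Q j})%:R :> R.
    apply: (le_trans (sub1 k fullv)); apply: ler_sum => j _; apply: ler_sum => a _.
    by rewrite surj.
  (* Each source has a nonnegative deficit and the deficits sum to zero, so the global identity
     splits into one per source. *)
  have /eqP : \sum_k (\sum_j \sum_(a : arrow Q k j) th j * (\dim {: target Q j})%:R -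
      (\dim {: source Q k})%:R) = 0 :> R.
    by rewrite sumrB scal subrr.
  rewrite psumr_eq0 => [/allP/(_ i (mem_index_enum _))|k _]; last by rewrite subr_ge0.
  by rewrite subr_eq0 => /eqP.
(* Arrows out of source [i], paired with their targets, form the single index type of the one-source
   problem. *)
pose J i := {j : 'I_m & arrow Q i j}.
have feas i : feasible (H := fun s : J i => hvect (target Q (tag s))) fullv
    (fun s : J i => arrow_map Q (tagged s)) (fun s : J i => th (tag s)).
  split; first by move=> s; exact: exponent_itv.
    rewrite scal1 (@sig_big_dep _ _ _ _ (arrow Q i) (fun=> true) (fun _ _ => true)
      (fun j (a : arrow Q i j) => th j * (\dim {: target Q j})%:R)) /=.
    by apply: eq_bigr => s _; rewrite surj.
  move=> U _; apply: (le_trans (sub1 i U)).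
  by rewrite (@sig_big_dep _ _ _ _ (arrow Q i) (fun=> true) (fun _ _ => true)
    (fun j (a : arrow Q i j) => th j * (\dim (arrow_map Q a @: U)%VS)%:R)).
have /choice[C HC] i := BL_single_source (fun s => arrow_map_surj (tagged s))
  (fun s => p_ge1 (tag s)) (feas i).
have C0 i : 0 < C i by have [] := HC i.
(* Both sides of the inequality factor over the sources, so the product of the one-source constants
   is admissible. *)
apply: (@le_lt_trans _ _ (\prod_i C i)%:E); last by rewrite ltry.
apply: ereal_inf_lbound; split; first by rewrite lee_fin prodr_ge0// => i _; exact: ltW.
move=> f mf f0; rewrite -prod_EFinM; apply: lee_prod => i.
  by apply: integral_ge0 => x _; do 2![apply: prode_ge0 => ? _].
have [_ /(_ (fun s : J i => f i (tag s) (tagged s)))] := HC i.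
move=> /(_ (fun s => mf _ _ _) (fun s => f0 _ _ _)).
congr (_ <= _ * _)%E.
  apply: eq_integral => x _; apply/esym.
  exact: (@sig_big_dep _ _ _ _ (arrow Q i) (fun=> true) (fun _ _ => true)
    (fun j (a : arrow Q i j) => f i j a (arrow_map Q a x))).
apply/esym; exact: (@sig_big_dep _ _ _ _ (arrow Q i) (fun=> true) (fun _ _ => true)
  (fun j (a : arrow Q i j) => 'N[hilbert_lebesgue (target Q j)]_(p j)[f i j a]%E)).
Qed.

Lemma sum_exponent_dim (D : forall i j, arrow Q i j -> nat) :
  (\sum_(i < n) \sum_(j < m) \sum_(a : arrow Q i j) (p j)^-1 * (D i j a)%:R%:E =
   (\sum_(i < n) \sum_(j < m) \sum_(a : arrow Q i j) th j * (D i j a)%:R)%:E)%E.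
Proof.
rewrite -sumEFin; apply: eq_bigr => i _; rewrite -sumEFin; apply: eq_bigr => j _.
by rewrite -sumEFin; apply: eq_bigr => a _; rewrite exponentE.
Qed.

End theorem.

Local Open Scope ereal_scope.

Theorem theorem1p10 (R : realType) (n m : nat) (Q : bipartite_rep R n m)
    (p : 'I_m -> \bar R) (p_ge1 : forall j, 1 <= p j) :
  BL_constant Q p < +oo <->
  (\sum_(i < n) (\dim {: source Q i})%:R%:E =
     \sum_(i < n) \sum_(j < m) \sum_(a : arrow Q i j)
       (p j)^-1 * (\dim {: target Q j})%:R%:E) /\
  (forall V : (forall i, {vspace (source Q i)}),
     \sum_(i < n) (\dim (V i))%:R%:E <=
     \sum_(i < n) \sum_(j < m) \sum_(a : arrow Q i j)
       (p j)^-1 * (\dim (arrow_map Q a @: V i)%VS)%:R%:E).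
Proof.
rewrite sum_exponent_dim// sumEFin; split.
  move=> /(BL_necessary p_ge1)[-> sub]; split => // V.
  by rewrite (sum_exponent_dim p_ge1 (fun i j a => \dim (arrow_map Q a @: V i)%VS)) sumEFin lee_fin.
move=> [[scal] sub]; apply: BL_sufficient => // V.
have := sub V.
by rewrite (sum_exponent_dim p_ge1 (fun i j a => \dim (arrow_map Q a @: V i)%VS)) sumEFin lee_fin.
Qed.
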